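(* Let $S\subset\mathbf{R}^3$ be a Gutkin billiard table (in the sense defined in the context) for some angle $\delta\in(0,\pi/2)$. Then $S$ is a round sphere.
   Context: A Gutkin billiard table in $\mathbf{R}^d$ is a smooth closed hypersurface $S$ bounding a compact convex domain, with all principal curvatures strictly positive everywhere, for which there exists $\delta\in(0,\pi/2)$ such that for every pair of distinct points $p,q\in S$: if the angle between the vector $\overrightarrow{pq}$ and the tangent hyperplane $T_pS$ equals $\delta$, then the angle between $\overrightarrow{pq}$ and the tangent hyperplane $T_qS$ also equals $\delta$. *)

(* Defs.v *)
From Stdlib Require Import Reals.
Open Scope R_scope.

Record R3 := mkR3 { x1 : R; x2 : R; x3 : R }.

Inductive idx := I1 | I2 | I3.

Definition coord (i : idx) (u : R3) : R :=
  match i with I1 => x1 u | I2 => x2 u | I3 => x3 u end.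

Definition vzero : R3 := mkR3 0 0 0.
Definition vadd (u v : R3) : R3 := mkR3 (x1 u + x1 v) (x2 u + x2 v) (x3 u + x3 v).
Definition vsub (u v : R3) : R3 := mkR3 (x1 u - x1 v) (x2 u - x2 v) (x3 u - x3 v).
Definition vscal (a : R) (u : R3) : R3 := mkR3 (a * x1 u) (a * x2 u) (a * x3 u).
Definition dot (u v : R3) : R := x1 u * x1 v + x2 u * x2 v + x3 u * x3 v.
Definition vnorm (u : R3) : R := sqrt (dot u u).

Definition basis (i : idx) : R3 :=
  match i with I1 => mkR3 1 0 0 | I2 => mkR3 0 1 0 | I3 => mkR3 0 0 1 end.

Definition is_partial (F : R3 -> R) (i : idx) (x : R3) (l : R) : Prop :=
  derivable_pt_lim (fun t => F (vadd x (vscal t (basis i)))) 0 l.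

Definition cont3 (F : R3 -> R) : Prop :=
  forall x eps, 0 < eps -> exists d, 0 < d /\
    forall y, vnorm (vsub y x) < d -> Rabs (F y - F x) < eps.

Fixpoint Ck (k : nat) (F : R3 -> R) : Prop :=
  match k with
  | O => cont3 F
  | S k' => cont3 F /\
      forall i : idx, exists G : R3 -> R,
        (forall x, is_partial F i x (G x)) /\ Ck k' G
  end.

Definition smooth (F : R3 -> R) : Prop := forall k, Ck k F.

Definition bounded_set (D : R3 -> Prop) : Prop :=
  exists M, forall x, D x -> vnorm x <= M.

Definition convex_set (D : R3 -> Prop) : Prop :=
  forall x y t, D x -> D y -> 0 <= t <= 1 ->
    D (vadd (vscal (1 - t) x) (vscal t y)).

(** Angle in [0, pi/2] between a nonzero vector [v] and the hyperplane
    with normal vector [n] (i.e. the plane n^perp). *)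
Definition angle_vec_plane (v n : R3) : R :=
  asin (Rabs (dot v n) / (vnorm v * vnorm n)).

Definition grad (DF : idx -> R3 -> R) (x : R3) : R3 :=
  mkR3 (DF I1 x) (DF I2 x) (DF I3 x).

Definition hess_form (HF : idx -> idx -> R3 -> R) (x v : R3) : R :=
  coord I1 v * (coord I1 v * HF I1 I1 x + coord I2 v * HF I1 I2 x + coord I3 v * HF I1 I3 x)
+ coord I2 v * (coord I1 v * HF I2 I1 x + coord I2 v * HF I2 I2 x + coord I3 v * HF I2 I3 x)
+ coord I3 v * (coord I1 v * HF I3 I1 x + coord I2 v * HF I3 I2 x + coord I3 v * HF I3 I3 x).

(** Gutkin billiard table in R^3 for the angle delta.
    S is a smooth closed surface, realised as the regular zero set of a
    smooth function F (DF = its first partials, HF = its second partials),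
    bounding the compact convex domain {F <= 0}; all principal curvatures are
    strictly positive (w.r.t. the inner normal -grad F / |grad F|), i.e. the
    second fundamental form  v |-> v^T Hess F(p) v / |grad F(p)|  is positive
    definite on the tangent plane T_pS = (grad F(p))^perp.  The Gutkin
    condition uses the angle between the vector pq and T_pS, whose normal
    is grad F(p). *)
Definition gutkin_table (S : R3 -> Prop) (delta : R) : Prop :=
  0 < delta < PI / 2 /\
  exists (F : R3 -> R) (DF : idx -> R3 -> R) (HF : idx -> idx -> R3 -> R),
    smooth F /\
    (forall i x, is_partial F i x (DF i x)) /\
    (forall i j x, is_partial (DF i) j x (HF i j x)) /\
    (forall x, S x <-> F x = 0) /\
    (exists p, S p) /\
    (forall p, S p -> grad DF p <> vzero) /\
    bounded_set (fun x => F x <= 0) /\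
    convex_set (fun x => F x <= 0) /\
    (forall p v, S p -> v <> vzero -> dot (grad DF p) v = 0 ->
       0 < hess_form HF p v) /\
    (forall p q, S p -> S q -> p <> q ->
       angle_vec_plane (vsub q p) (grad DF p) = delta ->
       angle_vec_plane (vsub q p) (grad DF q) = delta).

Definition round_sphere (S : R3 -> Prop) : Prop :=
  exists (c : R3) (r : R), 0 < r /\ forall x, S x <-> vnorm (vsub x c) = r.

(* Main.v *)
Require Import Defs.
From Stdlib Require Import Reals Lra Classical ClassicalEpsilon.
From Coquelicot Require Import Coquelicot.
Open Scope R_scope.

(** Let [s], [C] be the sine and cosine of the angle.  At a point [p] with inner normal
    [n], each unit tangent [T] determines the chord in direction [v = C T + s n]; let [L]
    be its length and [q] its far end.  Let [k = II(T,T)] and [m = II(T, n x T)].  When [p]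
    moves along the geodesic in direction [T], [q] moves with some speed [mu] in the
    tangential direction of [v] at [q] (billiard maps preserve the characteristics of an
    invariant hypersurface), and [L' = C (mu - 1)].  When [T] turns at [p],
    [(1/L)' = (C^2/s) m / mu], where [mu] is determined up to sign by [1/L], [k] and [m].
    Both [T] and [-T] see the same [k] and [m], so [L(T)] and [L(-T)] solve the same first
    order ODE; they agree somewhere by the intermediate value theorem, hence everywhere.
    So [L] is even in [T], its derivative along the geodesic flow is odd, and
    [C (mu - 1) = - C (mu - 1)], that is [mu = 1].  Then [L k^2 - 2 s k + s^2 L m^2 = 0] and
    [(1/L)' = (C^2/s) m], and differentiating the first identity yields [m K = 0] with [K]
    the Gauss curvature.  As [K > 0] every point is umbilic, with [L = 2 s / k]; now [L],
    and then the centre [p + n / k], is constant on the surface. *)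

(** The delicate point is that [T] and [-T] give the same ODE. The normal at the far end supplies a
    unit vector [(a, b)], and the relation between the two ends of a chord makes [(k - s/L, - s m)]
    equal to [rho (a, b)] with [rho = s mu / L]. So only [rho^2] is a function of [1/L], [k] and
    [m], and the sign of the root must be shown to be constant on the circle of directions. This
    reduces to [rho <> 0]. Where [rho] vanished, the far end would stand still to first order as [p]
    moves along [T], and so would its normal; this forces [a = 0], and the derivative of the
    relation along the circle would then be [C^2] instead of 0. At a fixed point [k] and [m] are
    trigonometric polynomials in the angle of [T], so turning [T] involves no derivative of
    curvature along the surface. Charts, geodesics and parallel transport are replaced by first
    order data: curves on the surface are exit points of moving rays, and a tangent field along a
    curve is only made parallel at one instant. *)

Definition cross (u v : R3) : R3 :=
  mkR3 (x2 u * x3 v - x3 u * x2 v) (x3 u * x1 v - x1 u * x3 v)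
       (x1 u * x2 v - x2 u * x1 v).

Lemma R3_ext (u v : R3) : (forall i, coord i u = coord i v) -> u = v.
Proof.
  intros H; destruct u as [a b c], v as [a' b' c'].
  generalize (H I1) (H I2) (H I3); simpl; intros; subst; reflexivity.
Qed.

Ltac vec_unfold :=
  unfold cross, dot, vadd, vsub, vscal, vzero in *; cbn [x1 x2 x3 coord basis] in *.
Ltac vec_ring := vec_unfold; ring.
Ltac vec_eq := apply R3_ext; intros []; vec_unfold; try ring.

Lemma dot_comm u v : dot u v = dot v u.
Proof. vec_ring. Qed.
Lemma dot_addr u v w : dot u (vadd v w) = dot u v + dot u w.
Proof. vec_ring. Qed.
Lemma dot_addl u v w : dot (vadd v w) u = dot v u + dot w u.
Proof. vec_ring. Qed.
Lemma dot_subr u v w : dot u (vsub v w) = dot u v - dot u w.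
Proof. vec_ring. Qed.
Lemma dot_scalr u a v : dot u (vscal a v) = a * dot u v.
Proof. vec_ring. Qed.
Lemma dot_scall u a v : dot (vscal a v) u = a * dot v u.
Proof. vec_ring. Qed.

(** * Norms and the Cauchy-Schwarz inequality *)

Lemma dot_self_ge0 u : 0 <= dot u u.
Proof. unfold dot; nra. Qed.

Lemma dot_self_eq0 u : dot u u = 0 -> u = vzero.
Proof.
  unfold dot; intros H; apply R3_ext; intros []; unfold vzero; cbn; nra.
Qed.

Lemma dot_self_gt0 u : u <> vzero -> 0 < dot u u.
Proof.
  intros H; destruct (Rle_lt_or_eq_dec _ _ (dot_self_ge0 u)) as [h | h]; auto.
  elim H; apply dot_self_eq0; auto.
Qed.

Lemma vnorm_sqr u : vnorm u * vnorm u = dot u u.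
Proof. apply sqrt_sqrt, dot_self_ge0. Qed.

Lemma vnorm_ge0 u : 0 <= vnorm u.
Proof. apply sqrt_pos. Qed.

Lemma vnorm_gt0 u : u <> vzero -> 0 < vnorm u.
Proof. intros H; apply sqrt_lt_R0, dot_self_gt0, H. Qed.

Lemma vnorm_unit u : dot u u = 1 -> vnorm u = 1.
Proof. intros H; unfold vnorm; rewrite H; apply sqrt_1. Qed.

Lemma vnorm_scal a u : 0 <= a -> vnorm (vscal a u) = a * vnorm u.
Proof.
  intros H; unfold vnorm; rewrite dot_scalr, dot_scall, <- Rmult_assoc.
  rewrite sqrt_mult_alt by nra; rewrite sqrt_square; auto.
Qed.

Lemma cauchy_schwarz u v : Rabs (dot u v) <= vnorm u * vnorm v.
Proof.
  apply Rsqr_incr_0_var.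
  - rewrite <- Rsqr_abs; unfold Rsqr.
    replace (vnorm u * vnorm v * (vnorm u * vnorm v))
      with ((vnorm u * vnorm u) * (vnorm v * vnorm v)) by ring.
    rewrite !vnorm_sqr.
    generalize (dot_self_ge0 (cross u v)); vec_unfold; nra.
  - apply Rmult_le_pos; apply vnorm_ge0.
Qed.

Lemma coord_le_vnorm i u : Rabs (coord i u) <= vnorm u.
Proof.
  rewrite <- sqrt_Rsqr_abs; apply sqrt_le_1_alt; unfold Rsqr, dot.
  destruct i; cbn; nra.
Qed.

(** The factor 2 is a convenient bound for [sqrt 3]. *)
Lemma vnorm_le_coord u r :
  (forall i, Rabs (coord i u) <= r) -> vnorm u <= 2 * r.
Proof.
  intros H.
  assert (Hi : forall i, coord i u * coord i u <= r * r).
  { intros i; specialize (H i); revert H; unfold Rabs; destruct Rcase_abs; nra. }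
  assert (0 <= r) by (eapply Rle_trans; [apply Rabs_pos | apply (H I1)]).
  unfold vnorm; rewrite <- (sqrt_square (2 * r)) by lra.
  apply sqrt_le_1_alt; generalize (Hi I1) (Hi I2) (Hi I3); unfold dot; cbn; nra.
Qed.

(** * Orthonormal frames *)

Definition orthonormal (n t : R3) : Prop :=
  dot n n = 1 /\ dot t t = 1 /\ dot n t = 0.

(* Mixed Gram determinant of (x, n, t) and (y, n, t). *)
Lemma orthonormal_dot n t x y : orthonormal n t ->
  dot x y = dot x n * dot y n + dot x t * dot y t
            + dot x (cross n t) * dot y (cross n t).
Proof.
  intros (H1 & H2 & H3).
  assert (G : dot x (cross n t) * dot y (cross n t)
    = dot x y * (dot n n * dot t t - dot n t * dot n t)
      - dot x n * (dot y n * dot t t - dot n t * dot y t)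
      + dot x t * (dot y n * dot n t - dot n n * dot y t)) by vec_ring.
  rewrite G, H1, H2, H3; ring.
Qed.

Lemma orthonormal_cross n t : orthonormal n t ->
  dot n (cross n t) = 0 /\ dot t (cross n t) = 0
  /\ dot (cross n t) (cross n t) = 1.
Proof.
  intros (H1 & H2 & H3); split; [vec_ring | split; [vec_ring |]].
  assert (G : dot (cross n t) (cross n t)
    = dot n n * dot t t - dot n t * dot n t) by vec_ring.
  rewrite G, H1, H2, H3; ring.
Qed.

Lemma orthonormal_ext n t x y : orthonormal n t ->
  dot n x = dot n y -> dot t x = dot t y ->
  dot (cross n t) x = dot (cross n t) y -> x = y.
Proof.
  intros Ho H1 H2 H3.
  assert (vsub x y = vzero).
  { apply dot_self_eq0; rewrite (orthonormal_dot n t) by auto.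
    rewrite !(dot_comm (vsub x y)), !dot_subr, H1, H2, H3; ring. }
  apply R3_ext; intros i; assert (E : coord i (vsub x y) = 0) by
    (rewrite H; destruct i; reflexivity).
  destruct i; cbn in *; lra.
Qed.

Lemma exists_unit_orth n : dot n n = 1 -> exists t, orthonormal n t.
Proof.
  intros Hn.
  assert (G : exists t, t <> vzero /\ dot n t = 0).
  { destruct (Req_dec (x1 n) 0) as [h | h].
    - exists (mkR3 1 0 0); split; [intros E; injection E; lra | vec_unfold; lra].
    - exists (mkR3 (- x2 n) (x1 n) 0); split;
        [intros E; injection E; lra | vec_ring]. }
  destruct G as (t & Ht & Hd).
  exists (vscal (/ vnorm t) t); pose proof (vnorm_gt0 t Ht).
  unfold orthonormal; rewrite !dot_scalr, dot_scall, Hd, <- (vnorm_sqr t).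
  repeat split; auto; field; lra.
Qed.

(** The cross product serves unless [u] and [v] are parallel; then a unit vector orthogonal to a
    nonzero one of them is orthogonal to both. The parallel case matters for joining opposite points
    of the surface. *)
Lemma exists_orth2 u v : exists e, e <> vzero /\ dot e u = 0 /\ dot e v = 0.
Proof.
  destruct (classic (cross u v = vzero)) as [H | H].
  2: { exists (cross u v); repeat split; auto; vec_ring. }
  destruct (classic (u = vzero)) as [Hu | Hu].
  - destruct (classic (v = vzero)) as [Hv | Hv].
    + exists (mkR3 1 0 0); subst; repeat split; try vec_ring.
      intros E; injection E; lra.
    + pose proof (vnorm_gt0 v Hv).
      destruct (exists_unit_orth (vscal (/ vnorm v) v)) as (e & _ & He & Hd).
      * rewrite dot_scalr, dot_scall, <- vnorm_sqr; field; lra.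
      * exists e; rewrite dot_scall in Hd; subst u; repeat split.
        -- intros E; subst e; vec_unfold; lra.
        -- vec_ring.
        -- rewrite dot_comm; apply Rmult_eq_reg_l with (/ vnorm v); [lra |].
           apply Rinv_neq_0_compat; lra.
  - pose proof (vnorm_gt0 u Hu).
    destruct (exists_unit_orth (vscal (/ vnorm u) u)) as (e & _ & He & Hd).
    + rewrite dot_scalr, dot_scall, <- vnorm_sqr; field; lra.
    + rewrite dot_scall in Hd.
      assert (D : dot u e = 0).
      { apply Rmult_eq_reg_l with (/ vnorm u); [lra |].
        apply Rinv_neq_0_compat; lra. }
      exists e; repeat split; [intros E; subst e; vec_unfold; lra | |].
      * rewrite dot_comm; auto.
      * assert (E : dot u u * dot e v = dot u v * dot u e
                  + dot e (cross (cross u v) u)) by vec_ring.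
        rewrite H, D in E.
        assert (E0 : dot e (cross vzero u) = 0) by vec_ring.
        rewrite E0 in E; pose proof (dot_self_gt0 u Hu).
        apply Rmult_eq_reg_l with (dot u u); lra.
Qed.

(** * Differentiable curves *)

Definition curve_derive (P : R -> R3) (t : R) (u : R3) : Prop :=
  forall i, is_derive (fun r => coord i (P r)) t (coord i u).

Lemma is_derive_eq (f : R -> R) (x l l' : R) : is_derive f x l -> l = l' -> is_derive f x l'.
Proof. intros H <-; exact H. Qed.

Lemma is_derive_Rconst (c x : R) : is_derive (fun _ : R => c) x 0.
Proof. apply (is_derive_const (K := R_AbsRing) (V := R_NormedModule)). Qed.

Lemma is_derive_Rext (f g : R -> R) (x l : R) :
  (forall t, f t = g t) -> is_derive f x l -> is_derive g x l.
Proof. intros H; apply is_derive_ext, H. Qed.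

Lemma is_derive_inj (f : R -> R) (x l l' : R) :
  is_derive f x l -> is_derive f x l' -> l = l'.
Proof.
  intros H H'; rewrite <- (is_derive_unique _ _ _ H); exact (is_derive_unique _ _ _ H').
Qed.

Lemma curve_derive_eq P t u u' : curve_derive P t u -> u = u' -> curve_derive P t u'.
Proof. intros H <-; exact H. Qed.

Lemma curve_derive_ext_loc P Q t u : locally t (fun r => P r = Q r) ->
  curve_derive P t u -> curve_derive Q t u.
Proof.
  intros H HP i; apply (is_derive_ext_loc (fun r => coord i (P r))); auto.
  revert H; apply filter_imp; intros r ->; reflexivity.
Qed.

Lemma is_derive_Rmult (f g : R -> R) x df dg : is_derive f x df ->
  is_derive g x dg -> is_derive (fun r => f r * g r) x (df * g x + f x * dg).
Proof. intros Hf Hg; apply (is_derive_mult f g); auto; intros; apply Rmult_comm. Qed.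

Lemma is_derive_Rplus (f g : R -> R) x df dg : is_derive f x df ->
  is_derive g x dg -> is_derive (fun r => f r + g r) x (df + dg).
Proof. intros; apply (is_derive_plus f g); auto. Qed.

Lemma curve_derive_const p t : curve_derive (fun _ => p) t vzero.
Proof. intros i; replace (coord i vzero) with 0 by (destruct i; reflexivity);
  apply is_derive_Rconst. Qed.

Lemma curve_derive_add P Q t u v : curve_derive P t u -> curve_derive Q t v ->
  curve_derive (fun r => vadd (P r) (Q r)) t (vadd u v).
Proof.
  intros HP HQ i; generalize (is_derive_Rplus _ _ _ _ _ (HP i) (HQ i));
  destruct i; exact (fun H => H).
Qed.

Lemma curve_derive_scal (a : R -> R) P t da u :
  is_derive a t da -> curve_derive P t u ->
  curve_derive (fun r => vscal (a r) (P r)) t (vadd (vscal da (P t)) (vscal (a t) u)).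
Proof.
  intros Ha HP i; generalize (is_derive_Rmult _ _ _ _ _ Ha (HP i));
  destruct i; exact (fun H => H).
Qed.

Lemma is_derive_dot P Q t u v : curve_derive P t u -> curve_derive Q t v ->
  is_derive (fun r => dot (P r) (Q r)) t (dot u (Q t) + dot (P t) v).
Proof.
  intros HP HQ.
  pose proof (is_derive_Rmult _ _ _ _ _ (HP I1) (HQ I1)) as H1.
  pose proof (is_derive_Rmult _ _ _ _ _ (HP I2) (HQ I2)) as H2.
  pose proof (is_derive_Rmult _ _ _ _ _ (HP I3) (HQ I3)) as H3.
  pose proof (is_derive_Rplus _ _ _ _ _ (is_derive_Rplus _ _ _ _ _ H1 H2) H3) as H.
  refine (is_derive_eq _ _ _ _ H _); unfold dot; cbn; ring.
Qed.

Lemma is_derive_continuous (f : R -> R) x l : is_derive f x l -> continuous f x.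
Proof.
  intros H; apply (ex_derive_continuous (K := R_AbsRing) (V := R_NormedModule)).
  exists l; exact H.
Qed.

Lemma continuous_close (f : R -> R) (t eps : R) : continuous f t -> 0 < eps ->
  locally t (fun r => Rabs (f r - f t) < eps).
Proof. intros H He; exact (H _ (locally_ball (f t) (mkposreal eps He))). Qed.

Definition curve_continuous (P : R -> R3) (t : R) : Prop :=
  forall i, continuous (fun r => coord i (P r)) t.

Lemma curve_derive_continuous P t u : curve_derive P t u -> curve_continuous P t.
Proof. intros H i; exact (is_derive_continuous _ _ _ (H i)). Qed.

Lemma curve_continuous_close P t eps : curve_continuous P t -> 0 < eps ->
  locally t (fun r => vnorm (vsub (P r) (P t)) < eps).
Proof.
  intros H He.
  assert (Hi : forall i, locally t (fun r => Rabs (coord i (P r) - coord i (P t)) < eps / 3)).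
  { intros i; apply (continuous_close (fun r => coord i (P r))); [apply H | lra]. }
  generalize (filter_and _ _ (Hi I1) (filter_and _ _ (Hi I2) (Hi I3))).
  apply filter_imp; intros r (h1 & h2 & h3).
  apply Rle_lt_trans with (2 * (eps / 3)); [| lra].
  apply vnorm_le_coord; intros []; cbn; apply Rlt_le; assumption.
Qed.

Definition cont3_at (G : R3 -> R) (x : R3) : Prop :=
  forall eps, 0 < eps -> exists d, 0 < d /\
    forall y, vnorm (vsub y x) < d -> Rabs (G y - G x) < eps.

Lemma continuous_comp_curve G P t : cont3_at G (P t) -> curve_continuous P t ->
  continuous (fun r => G (P r)) t.
Proof.
  intros HG HP; apply filterlim_locally; intros eps.
  destruct (HG eps (cond_pos eps)) as (d & Hd & H).
  generalize (curve_continuous_close P t d HP Hd); apply filter_imp.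
  intros r Hr; apply H, Hr.
Qed.

(* The factor [a] need only be continuous since [q] vanishes at [t] after centring. *)
Lemma is_derive_continuous_mul (a q : R -> R) t dq :
  continuous a t -> is_derive q t dq ->
  is_derive (fun r => a r * (q r - q t)) t (a t * dq).
Proof.
  intros Ha Hq; apply is_derive_Reals; apply is_derive_Reals in Hq.
  intros eps He.
  assert (Ha' : forall e, 0 < e -> exists d, 0 < d /\
     forall h, Rabs h < d -> Rabs (a (t + h) - a t) < e).
  { intros e He'; destruct (Ha _ (locally_ball (a t) (mkposreal e He'))) as (d & Hd).
    exists d; split; [apply cond_pos |]; intros h Hh; apply Hd.
    change (Rabs (t + h - t) < d); replace (t + h - t) with h by ring; auto. }
  set (M := Rabs (a t) + 1); set (K := Rabs dq + 1).
  assert (HM : 0 < M) by (unfold M; pose proof (Rabs_pos (a t)); lra).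
  assert (HK : 0 < K) by (unfold K; pose proof (Rabs_pos dq); lra).
  assert (e1 : 0 < eps / (2 * M)) by (apply Rdiv_lt_0_compat; lra).
  (* The bound 1 yields [|a (t + h)| <= M]; the other bound controls the term
     [(a (t + h) - a t) dq]. *)
  assert (e2 : 0 < Rmin 1 (eps / (2 * K))).
  { apply Rmin_glb_lt; [lra | apply Rdiv_lt_0_compat; lra]. }
  destruct (Hq _ e1) as (d1 & H1); destruct (Ha' _ e2) as (d2 & Hd2 & H2).
  assert (Hd : 0 < Rmin d1 d2) by (apply Rmin_glb_lt; auto; apply cond_pos).
  exists (mkposreal _ Hd); cbn; intros h Hh0 Hh.
  specialize (H1 h Hh0 (Rlt_le_trans _ _ _ Hh (Rmin_l _ _))).
  specialize (H2 h (Rlt_le_trans _ _ _ Hh (Rmin_r _ _))).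
  pose proof (Rlt_le_trans _ _ _ H2 (Rmin_l _ _)) as H21.
  pose proof (Rlt_le_trans _ _ _ H2 (Rmin_r _ _)) as H22.
  replace ((a (t + h) * (q (t + h) - q t) - a t * (q t - q t)) / h - a t * dq)
    with (a (t + h) * ((q (t + h) - q t) / h - dq) + (a (t + h) - a t) * dq)
    by (field; auto).
  assert (B : Rabs (a (t + h)) <= M).
  { replace (a (t + h)) with (a t + (a (t + h) - a t)) by ring.
    eapply Rle_trans; [apply Rabs_triang |]; unfold M; lra. }
  eapply Rle_lt_trans; [apply Rabs_triang |]; rewrite !Rabs_mult.
  assert (B1 : Rabs (a (t + h)) * Rabs ((q (t + h) - q t) / h - dq) <= M * (eps / (2 * M))).
  { apply Rmult_le_compat; try apply Rabs_pos; lra. }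
  assert (B2 : Rabs (a (t + h) - a t) * Rabs dq <= eps / (2 * K) * Rabs dq).
  { apply Rmult_le_compat_r; [apply Rabs_pos | lra]. }
  assert (B3 : eps / (2 * K) * Rabs dq < eps / 2).
  { replace (eps / 2) with (eps / (2 * K) * K) by (field; lra).
    apply Rmult_lt_compat_l; [apply Rdiv_lt_0_compat; lra | unfold K; lra]. }
  replace (M * (eps / (2 * M))) with (eps / 2) in B1 by (field; lra); lra.
Qed.

(** * Functions of class C1 on R3 *)

Definition C1_with (G : R3 -> R) (DG : idx -> R3 -> R) : Prop :=
  (forall i x, is_partial G i x (DG i x)) /\ forall i, cont3 (DG i).

Lemma is_partial_unique G i x l l' :
  is_partial G i x l -> is_partial G i x l' -> l = l'.
Proof. apply uniqueness_limite. Qed.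

Lemma is_partial_shift G i x t l :
  is_partial G i (vadd x (vscal t (basis i))) l ->
  is_derive (fun r => G (vadd x (vscal r (basis i)))) t l.
Proof.
  intros H; apply is_derive_Reals; intros eps He.
  destruct (H eps He) as (d & Hd); exists d; intros h Hh0 Hh.
  specialize (Hd h Hh0 Hh).
  replace (vadd x (vscal (t + h) (basis i)))
    with (vadd (vadd x (vscal t (basis i))) (vscal (0 + h) (basis i)))
    by (destruct i; vec_eq).
  replace (vadd (vadd x (vscal t (basis i))) (vscal 0 (basis i)))
    with (vadd x (vscal t (basis i))) in Hd by (destruct i; vec_eq).
  exact Hd.
Qed.

Lemma MVT_partial G DG i x t : C1_with G DG ->
  exists c, Rabs c <= Rabs t /\
    G (vadd x (vscal t (basis i))) - G x = DG i (vadd x (vscal c (basis i))) * t.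
Proof.
  intros (HG & _).
  destruct (MVT_gen (fun r => G (vadd x (vscal r (basis i)))) 0 t
     (fun r => DG i (vadd x (vscal r (basis i))))) as (c & Hc & E).
  - intros r _; apply is_partial_shift, HG.
  - intros r _; apply continuity_pt_filterlim.
    eapply is_derive_continuous, is_partial_shift, HG.
  - exists c; split.
    + revert Hc; unfold Rmin, Rmax, Rabs.
      destruct (Rle_dec 0 t), (Rcase_abs c), (Rcase_abs t); lra.
    + replace (vadd x (vscal 0 (basis i))) with x in E by (destruct i; vec_eq).
      rewrite E; ring.
Qed.

(** The mean value theorem on the three axis-parallel edges of a path from [x] to [y]. Each
    coordinate of [z - x] is at most [|y - x|], whence the factor 2. *)
Lemma C1_increment G DG x y : C1_with G DG ->
  exists a, G y - G x = dot a (vsub y x) /\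
    forall i, exists z, vnorm (vsub z x) <= 2 * vnorm (vsub y x) /\ coord i a = DG i z.
Proof.
  intros HG.
  set (y1 := vadd x (vscal (x1 y - x1 x) (basis I1))).
  set (y2 := vadd y1 (vscal (x2 y - x2 x) (basis I2))).
  destruct (MVT_partial G DG I1 x (x1 y - x1 x) HG) as (c1 & h1 & E1).
  destruct (MVT_partial G DG I2 y1 (x2 y - x2 x) HG) as (c2 & h2 & E2).
  destruct (MVT_partial G DG I3 y2 (x3 y - x3 x) HG) as (c3 & h3 & E3).
  fold y1 in E1; fold y2 in E2.
  assert (E : vadd y2 (vscal (x3 y - x3 x) (basis I3)) = y)
    by (unfold y2, y1; vec_eq).
  rewrite E in E3.
  pose proof (coord_le_vnorm I1 (vsub y x)) as n1.
  pose proof (coord_le_vnorm I2 (vsub y x)) as n2.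
  pose proof (coord_le_vnorm I3 (vsub y x)) as n3.
  cbn in n1, n2, n3.
  pose proof (vnorm_ge0 (vsub y x)) as n0.
  exists (mkR3 (DG I1 (vadd x (vscal c1 (basis I1)))) (DG I2 (vadd y1 (vscal c2 (basis I2))))
        (DG I3 (vadd y2 (vscal c3 (basis I3))))).
  split.
  - replace (G y - G x) with ((G y1 - G x) + (G y2 - G y1) + (G y - G y2)) by ring.
    rewrite E1, E2, E3; unfold dot; cbn; ring.
  - intros []; eexists; (split; [| reflexivity]); apply vnorm_le_coord; intros [];
    unfold y2, y1; cbn;
    match goal with |- Rabs ?e <= _ => ring_simplify e end;
    rewrite ?Rabs_R0; try lra;
    rewrite ?(Rplus_comm (- _)); unfold Rminus in *; try lra.
Qed.

(** Differentiability in the form of Caratheodory: an exact slope, continuous at [x]. It gives the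
    chain rule, and later the derivative of an implicitly defined length, with no remainder
    terms. *)
Lemma C1_slope G DG x : C1_with G DG ->
  exists A : idx -> R3 -> R,
    (forall y, G y - G x = dot (grad A y) (vsub y x)) /\
    (forall i, A i x = DG i x) /\ (forall i, cont3_at (A i) x).
Proof.
  intros HG.
  destruct (choice _ (fun y => C1_increment G DG x y HG)) as (a & Ha).
  assert (Hx : forall i, coord i (a x) = DG i x).
  { intros i; destruct (proj2 (Ha x) i) as (z & Hz & ->); f_equal.
    assert (E : vnorm (vsub x x) = 0).
    { replace (vsub x x) with vzero by vec_eq; unfold vnorm.
      replace (dot vzero vzero) with 0 by vec_ring; apply sqrt_0. }
    rewrite E in Hz; apply R3_ext; intros j.
    pose proof (coord_le_vnorm j (vsub z x)) as H.
    pose proof (Rabs_pos (coord j (vsub z x))) as H'.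
    assert (H0 : Rabs (coord j (vsub z x)) = 0) by lra.
    destruct (Req_dec (coord j (vsub z x)) 0) as [e | e].
    - destruct j; cbn in *; lra.
    - elim (Rabs_no_R0 _ e H0). }
  exists (fun i y => coord i (a y)); split; [| split]; auto.
  - intros y; rewrite (proj1 (Ha y)); reflexivity.
  - intros i eps He; destruct (proj2 HG i x eps He) as (d & Hd & H).
    exists (d / 2); split; [lra |]; intros y Hy.
    destruct (proj2 (Ha y) i) as (z & Hz & ->).
    rewrite Hx; apply H; lra.
Qed.

Lemma is_derive_comp_C1 G DG P t u : C1_with G DG -> curve_derive P t u ->
  is_derive (fun r => G (P r)) t (dot (grad DG (P t)) u).
Proof.
  intros HG HP; destruct (C1_slope G DG (P t) HG) as (A & HA & HAx & HAc).
  pose proof (curve_derive_continuous _ _ _ HP) as Hc.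
  assert (Hi : forall i, is_derive (fun r => A i (P r) * (coord i (P r) - coord i (P t))) t
                 (DG i (P t) * coord i u)).
  { intros i; rewrite <- HAx.
    apply (is_derive_continuous_mul (fun r => A i (P r)) (fun r => coord i (P r))); auto.
    apply (continuous_comp_curve (A i)); auto. }
  apply (is_derive_Rext (fun r => G (P t) +
     (A I1 (P r) * (coord I1 (P r) - coord I1 (P t))
      + A I2 (P r) * (coord I2 (P r) - coord I2 (P t))
      + A I3 (P r) * (coord I3 (P r) - coord I3 (P t))))).
  - intros r.
    replace (G (P r)) with (G (P t) + (G (P r) - G (P t))) by ring.
    rewrite HA; unfold dot; cbn; ring.
  - pose proof (is_derive_Rplus _ _ _ _ _ (is_derive_Rplus _ _ _ _ _ (Hi I1) (Hi I2)) (Hi I3)) as H.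
    pose proof (is_derive_Rplus _ _ _ _ _
      (is_derive_Rconst (G (P t)) t) H) as H'.
    refine (is_derive_eq _ _ _ _ H' _).
    unfold dot, grad, zero; cbn; ring.
Qed.

(** * Constancy, linear differential equations and constancy of sign *)

Lemma is_derive_zero_const (f : R -> R) x y :
  (forall t, is_derive f t 0) -> f x = f y.
Proof.
  intros H; destruct (Rtotal_order x y) as [h | [-> | h]]; auto.
  - apply (eq_is_derive (V := R_NormedModule)); auto.
  - symmetry; apply (eq_is_derive (V := R_NormedModule)); auto.
Qed.

(** Multiplying [h] by the integrating factor [exp (- RInt r t0 t)] makes it constant. *)
Lemma linear_ode_zero (h r : R -> R) t0 :
  (forall t, is_derive h t (r t * h t)) -> (forall t, continuous r t) ->
  h t0 = 0 -> forall t, h t = 0.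
Proof.
  intros Hh Hr H0 t.
  assert (HI : forall x, is_derive (fun y => RInt r t0 y) x (r x)).
  { intros x; apply (is_derive_RInt r (fun y => RInt r t0 y) t0); auto.
    apply filter_forall; intros y; apply (RInt_correct r t0 y).
    apply (ex_RInt_continuous (V := R_CompleteNormedModule)); auto. }
  assert (HE : forall x, is_derive (fun y => h y * exp (- RInt r t0 y)) x 0).
  { intros x.
    assert (E : is_derive (fun y => exp (- RInt r t0 y)) x (- r x * exp (- RInt r t0 x))).
    { apply (is_derive_comp (V := R_NormedModule) exp (fun y => - RInt r t0 y)).
      - apply is_derive_exp.
      - apply (is_derive_opp (V := R_NormedModule) (fun y => RInt r t0 y)), HI. }
    refine (is_derive_eq _ _ _ _ (is_derive_Rmult _ _ _ _ _ (Hh x) E) _); ring. }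
  pose proof (is_derive_zero_const _ t t0 HE) as E; cbv beta in E.
  rewrite H0, Rmult_0_l in E.
  pose proof (exp_pos (- RInt r t0 t)).
  destruct (Rmult_integral _ _ E); lra.
Qed.

Lemma IVT_same_sign (g : R -> R) :
  (forall x, continuous g x) -> (forall x, g x <> 0) -> forall x y, 0 < g x * g y.
Proof.
  intros Hg H0 x y; destruct (Rlt_or_le 0 (g x * g y)) as [h | h]; auto.
  destruct (IVT_gen g x y 0) as (z & _ & Hz).
  - intros z; apply continuity_pt_filterlim, Hg.
  - pose proof (H0 x); pose proof (H0 y).
    unfold Rmin, Rmax; destruct (Rle_dec (g x) (g y)); nra.
  - elim (H0 z Hz).
Qed.

(** * The chord length as a function of the direction *)

Section Circle.

Variables (s C : R) (L a b k m : R -> R).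
Hypothesis (Hs : 0 < s) (HC : 0 < C).
Hypothesis HL : forall x, 0 < L x.
Hypothesis Hk : forall x, 0 < k x.
Hypothesis Hab : forall x, a x * a x + b x * b x = 1.
Hypothesis Hrel : forall x, b x * (L x * k x - s) = - (s * m x * L x * a x).
Hypothesis dL : forall x, is_derive L x (C * C / s * L x * b x).
Hypothesis dk : forall x, is_derive k x (2 * m x).

(** * Evenness of the chord length in the direction *)

Section Even.
Hypothesis da : forall x, ex_derive a x.
Hypothesis db : forall x, ex_derive b x.
Hypothesis dm : forall x, ex_derive m x.
Hypothesis Hdeg : forall x, L x * k x = s -> m x = 0 -> a x = 0.
Hypothesis kpi : forall x, k (x + PI) = k x.
Hypothesis mpi : forall x, m (x + PI) = m x.
Hypothesis L2pi : forall x, L (x + 2 * PI) = L x.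

(* [rho = s mu / L], where [mu] is the speed of the far end of the chord when the near
   end moves along a geodesic at unit speed. *)
Let rho x := a x * (k x - s / L x) - b x * s * m x.

(** [Hrel] says that [(k - s/L, - s m)] is parallel to the unit vector [(a, b)]. As [rho] is their
    inner product, the vector is [rho (a, b)]; this is its first coordinate and [rho_b] the
    second. *)
Lemma rho_a x : a x * rho x = k x - s / L x.
Proof.
  unfold rho; generalize (Hrel x) (HL x) (Hab x); intros E P Q.
  assert (E' : b x * (k x - s / L x) = - (s * m x * a x)).
  { apply Rmult_eq_reg_r with (L x); [| lra].
    rewrite Rmult_assoc, Rmult_minus_distr_r.
    replace (s / L x * L x) with s by (field; lra); lra. }
  replace (a x * (a x * (k x - s / L x) - b x * s * m x))
    with (a x * a x * (k x - s / L x) + b x * (- (s * m x * a x))) by ring.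
  rewrite <- E'; replace (a x * a x) with (1 - b x * b x) by lra; ring.
Qed.

Lemma rho_b x : b x * rho x = - (s * m x).
Proof.
  unfold rho; generalize (Hrel x) (HL x) (Hab x); intros E P Q.
  assert (E' : b x * (k x - s / L x) = - (s * m x * a x)).
  { apply Rmult_eq_reg_r with (L x); [| lra].
    rewrite Rmult_assoc, Rmult_minus_distr_r.
    replace (s / L x * L x) with s by (field; lra); lra. }
  replace (b x * (a x * (k x - s / L x) - b x * s * m x))
    with (a x * (b x * (k x - s / L x)) - b x * b x * (s * m x)) by ring.
  rewrite E'; replace (b x * b x) with (1 - a x * a x) by lra; ring.
Qed.

Lemma rho_sqr x :
  rho x * rho x = (k x - s / L x) * (k x - s / L x) + s * m x * (s * m x).
Proof.
  rewrite <- rho_a; replace (s * m x) with (- (b x * rho x)) by (rewrite rho_b; ring).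
  replace (a x * rho x * (a x * rho x) + - (b x * rho x) * - (b x * rho x))
    with ((a x * a x + b x * b x) * (rho x * rho x)) by ring.
  rewrite Hab; ring.
Qed.

(** A zero of [rho] forces [L k = s] and [m = 0], hence [a = 0] by [Hdeg] and [b^2 = 1]. In the
    derivative of [Hrel] only the term [b L' k] then survives; it equals [C^2], although it should
    be 0. *)
Lemma rho_neq0 x : rho x <> 0.
Proof.
  intros H0; pose proof (rho_a x) as Ea; pose proof (rho_b x) as Eb.
  rewrite H0 in Ea, Eb.
  assert (Hm : m x = 0).
  { apply Rmult_eq_reg_l with s; lra. }
  assert (HD : L x * k x = s).
  { replace (k x) with (s / L x) by lra; field; generalize (HL x); lra. }
  pose proof (Hdeg x HD Hm) as Ha.
  assert (Hb : b x * b x = 1) by (generalize (Hab x); rewrite Ha; lra).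
  assert (E : is_derive (fun y => b y * (L y * k y - s) + s * m y * L y * a y) x 0).
  { apply (is_derive_Rext (fun _ => 0)); [intros y; rewrite Hrel; ring |].
    apply is_derive_Rconst. }
  assert (E' : is_derive (fun y => b y * (L y * k y - s) + s * m y * L y * a y) x
      (C * C / s * (L x * k x))).
  { auto_derive.
    - repeat split; auto; eexists; eauto.
    - rewrite (is_derive_unique (fun y : R => L y) _ _ (dL x)), (is_derive_unique (fun y : R => k y) _ _ (dk x)).
      rewrite HD, Hm, Ha.
      transitivity (C * C / s * (L x * k x) * (b x * b x)); [ring |].
      rewrite Hb, HD; ring. }
  pose proof (is_derive_unique _ _ _ E) as U; rewrite (is_derive_unique _ _ _ E') in U.
  rewrite HD in U; replace (C * C / s * s) with (C * C) in U by (field; lra).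
  nra.
Qed.

Lemma rho_derivable x : ex_derive rho x.
Proof.
  unfold rho; auto_derive; repeat split; auto; try (eexists; eauto).
  generalize (HL x); lra.
Qed.

Lemma rho_continuous x : continuous rho x.
Proof. apply (ex_derive_continuous (K := R_AbsRing) (V := R_NormedModule)), rho_derivable. Qed.

Lemma inv_L_derive x : is_derive (fun y => / L y) x (C * C * m x / L x / rho x).
Proof.
  refine (is_derive_eq _ _ _ _ (is_derive_inv _ _ _ (dL x) _) _).
  - generalize (HL x); lra.
  - assert (Em : m x = - (b x * rho x) / s).
    { apply Rmult_eq_reg_l with s; [| lra]; pose proof (rho_b x).
      replace (s * (- (b x * rho x) / s)) with (- (b x * rho x)) by (field; lra); lra. }
    rewrite Em; generalize (HL x) (rho_neq0 x); intros; field; repeat split; lra.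
Qed.

Let f x := / L x.
Let h x := f x - f (x + PI).
Let r x := C * C * m x *
  (rho (x + PI) + f (x + PI) * (s * (2 * k x - s * f x - s * f (x + PI)))
                   / (rho x + rho (x + PI))) / (rho x * rho (x + PI)).

(** Being continuous without zeros, [rho] has the same sign at opposite directions. This selects the
    same branch of the square root for both and permits division by the sum. *)
Lemma rho_sum_neq0 x : rho x + rho (x + PI) <> 0.
Proof.
  pose proof (IVT_same_sign rho rho_continuous rho_neq0 x (x + PI)) as P.
  intros E; replace (rho (x + PI)) with (- rho x) in P by lra; nra.
Qed.

Lemma shift_derive (g : R -> R) x l :
  is_derive g (x + PI) l -> is_derive (fun y => g (y + PI)) x l.
Proof.
  intros H; refine (is_derive_eq _ _ _ _ (is_derive_comp g (fun y => y + PI) x l 1 H _) _).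
  - auto_derive; auto.
  - unfold scal; cbn; unfold mult; cbn; ring.
Qed.

(* Both [1/L] and its shift by [PI] solve the same ODE, so their difference solves
   a linear homogeneous one. *)
Lemma inv_L_diff_derive x : is_derive h x (r x * h x).
Proof.
  pose proof (inv_L_derive x) as D1.
  pose proof (shift_derive (fun y => / L y) x _ (inv_L_derive (x + PI))) as D2.
  refine (is_derive_eq _ _ _ _ (is_derive_minus (V := R_NormedModule) _ _ _ _ _ D1 D2) _).
  change (minus ?u ?v) with (u - v); rewrite mpi.
  pose proof (rho_sqr x) as S1; pose proof (rho_sqr (x + PI)) as S2.
  rewrite kpi, mpi in S2.
  generalize (rho_neq0 x) (rho_neq0 (x + PI)) (rho_sum_neq0 x); intros n1 n2 n3.
  unfold r, h; unfold Rdiv in *; fold (f x) in *; fold (f (x + PI)) in *.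
  set (f1 := f x) in *; set (f2 := f (x + PI)) in *.
  set (r1 := rho x) in *; set (r2 := rho (x + PI)) in *.
  (* The difference of the two instances of [rho_sqr], in which [m] cancels: it expresses [r2 - r1]
     as a multiple of [f1 - f2]. *)
  assert (E : s * (2 * k x - s * f1 - s * f2) * (f1 - f2) = (r2 - r1) * (r1 + r2)).
  { replace ((r2 - r1) * (r1 + r2)) with (r2 * r2 - r1 * r1) by ring.
    rewrite S1, S2; ring. }
  transitivity (C * C * m x * (r2 * (f1 - f2) +
    f2 * (s * (2 * k x - s * f1 - s * f2) * (f1 - f2)) * / (r1 + r2)) * / (r1 * r2)).
  - rewrite E; field; repeat split; auto.
  - field; repeat split; auto.
Qed.

Lemma inv_L_coef_continuous x : continuous r x.
Proof.
  apply (ex_derive_continuous (K := R_AbsRing) (V := R_NormedModule)).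
  assert (A : forall g : R -> R, (forall y, ex_derive g y) -> ex_derive (fun y => g (y + PI)) x).
  { intros g Hg; destruct (Hg (x + PI)) as (l & Hl); exists l; apply shift_derive, Hl. }
  pose proof (A rho rho_derivable) as R2.
  assert (Ef : forall y, ex_derive f y) by (intros y; eexists; apply inv_L_derive).
  pose proof (A f Ef) as F2.
  set (rp := fun y => rho (y + PI)); set (fp := fun y => f (y + PI)).
  change (ex_derive rp x) in R2; change (ex_derive fp x) in F2.
  assert (ex_derive k x) by (eexists; apply dk).
  generalize (Ef x) (rho_derivable x) (dm x); intros.
  apply (ex_derive_ext (fun x => C * C * m x *
    (rp x + fp x * (s * (2 * k x - s * f x - s * fp x))
                   / (rho x + rp x)) / (rho x * rp x))); [intros; reflexivity |].
  generalize (rho_sum_neq0 x) (rho_neq0 x) (rho_neq0 (x + PI)).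
  fold (rp x); intros; clearbody f rp fp rho.
  auto_derive; repeat split; auto.
Qed.

(** Once [L] agrees at [x] and [x + PI], [rho_sqr] makes the two values of [rho] equal up to sign
    and [rho_sum_neq0] excludes opposite signs; dividing [rho_a] and [rho_b] by [rho] recovers [a]
    and [b]. *)
Lemma circle_even x : L (x + PI) = L x /\ a (x + PI) = a x /\ b (x + PI) = b x.
Proof.
  assert (Hc : forall y, continuous h y) by
    (intros y; eapply is_derive_continuous, inv_L_diff_derive).
  assert (Hanti : forall y, h (y + PI) = - h y).
  { intros y; unfold h, f; replace (y + PI + PI) with (y + 2 * PI) by ring.
    rewrite L2pi; ring. }
  assert (Hz : exists z, h z = 0).
  { apply NNPP; intros N.
    pose proof (IVT_same_sign h Hc (fun z E => N (ex_intro _ z E)) 0 (0 + PI)) as P.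
    rewrite Hanti in P; nra. }
  destruct Hz as (z & Hz).
  pose proof (linear_ode_zero h r z inv_L_diff_derive inv_L_coef_continuous Hz x) as E.
  assert (EL : L (x + PI) = L x).
  { unfold h, f in E; generalize (HL x) (HL (x + PI)); intros.
    rewrite <- (Rinv_inv (L x)), <- (Rinv_inv (L (x + PI))); f_equal; lra. }
  assert (Er : rho (x + PI) = rho x).
  { pose proof (rho_sqr (x + PI)) as S2; rewrite kpi, mpi, EL, <- rho_sqr in S2.
    pose proof (rho_sum_neq0 x).
    assert ((rho (x + PI) - rho x) * (rho x + rho (x + PI)) = 0) by nra.
    destruct (Rmult_integral _ _ H0); lra. }
  repeat split; auto; apply Rmult_eq_reg_r with (rho x); try apply rho_neq0.
  - rewrite rho_a, <- Er, rho_a, kpi, EL; reflexivity.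
  - rewrite rho_b, <- Er, rho_b, mpi; reflexivity.
Qed.

End Even.

(** * Consequences of unit speed at the far end *)

Section UnitSpeed.

Variable k' : R -> R.
Hypothesis dm' : forall x, is_derive m x (k' x - k x).
Hypothesis HK : forall x, 0 < k x * k' x - m x * m x.
Hypothesis Hcos : C * C + s * s = 1.
Hypothesis Hmu : forall x, a x * (L x * k x - s) / s - L x * m x * b x = 1.

(** The vector [(L k - s, - s L m)] is parallel to the unit vector [(a, b)] by [Hrel] and has inner
    product [s] with it by [Hmu], so it is [s (a, b)]. Comparing squared lengths gives
    [unit_speed_quadratic]. *)
Lemma unit_speed_ab x : a x * s = L x * k x - s /\ b x = - (L x * m x).
Proof.
  generalize (Hmu x) (Hrel x) (Hab x); intros E1 E2 E3.
  assert (E : a x * (L x * k x - s) - s * L x * m x * b x = s).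
  { rewrite <- (Rmult_1_l s) at 3; rewrite <- E1; field; lra. }
  split.
  - transitivity (a x * (a x * (L x * k x - s) - s * L x * m x * b x)); [now rewrite E |].
    transitivity (a x * a x * (L x * k x - s) + b x * (- (s * m x * L x * a x))); [ring |].
    rewrite <- E2; replace (a x * a x) with (1 - b x * b x) by lra; ring.
  - apply Rmult_eq_reg_r with s; [| lra].
    transitivity (b x * (a x * (L x * k x - s) - s * L x * m x * b x)); [now rewrite E |].
    transitivity (a x * (b x * (L x * k x - s)) - b x * b x * (s * L x * m x)); [ring |].
    rewrite E2; replace (b x * b x) with (1 - a x * a x) by lra; ring.
Qed.

Lemma unit_speed_quadratic x :
  L x * (k x * k x) - 2 * s * k x + s * s * L x * (m x * m x) = 0.
Proof.
  destruct (unit_speed_ab x) as [E1 E2].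
  apply Rmult_eq_reg_l with (L x); [| generalize (HL x); lra].
  transitivity ((L x * k x - s) * (L x * k x - s) + s * s * (- (L x * m x) * - (L x * m x)) - s * s);
    [ring |].
  rewrite <- E1, <- E2.
  transitivity (s * s * (a x * a x + b x * b x) - s * s); [ring | rewrite Hab; ring].
Qed.

(* Differentiating [unit_speed_quadratic] leaves [m] times the Gauss curvature. *)
Lemma unit_speed_umbilic x : m x = 0 /\ L x * k x = 2 * s /\ a x = 1 /\ b x = 0.
Proof.
  assert (E : is_derive (fun y => L y * (k y * k y) - 2 * s * k y + s * s * L y * (m y * m y)) x 0).
  { apply (is_derive_Rext (fun _ => 0)); [intros y; now rewrite unit_speed_quadratic |].
    apply is_derive_Rconst. }
  assert (D : is_derive (fun y => L y * (k y * k y) - 2 * s * k y + s * s * L y * (m y * m y)) x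
     (- (C * C / s) * L x * m x * (L x * (k x * k x) + s * s * L x * (m x * m x))
      + 4 * L x * k x * m x - 4 * s * m x + 2 * (s * s) * L x * m x * (k' x - k x))).
  { auto_derive.
    - repeat split; auto; eexists; eauto.
    - rewrite (is_derive_unique (fun y : R => L y) _ _ (dL x)), (is_derive_unique (fun y : R => k y) _ _ (dk x)),
        (is_derive_unique (fun y : R => m y) _ _ (dm' x)), (proj2 (unit_speed_ab x)); ring. }
  pose proof (is_derive_unique _ _ _ E) as U; rewrite (is_derive_unique _ _ _ D) in U.
  pose proof (unit_speed_quadratic x) as Q.
  generalize (HL x) (Hk x) (HK x); intros.
  assert (Z : m x * (2 * (s * s) * L x * (k x * k' x - m x * m x)) = 0).
  { replace (L x * (k x * k x) + s * s * L x * (m x * m x)) with (2 * s * k x) in U by lra.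
    replace (- (C * C / s) * L x * m x * (2 * s * k x))
      with (- (2 * (C * C) * L x * m x * k x)) in U by (field; lra).
    replace (C * C) with (1 - s * s) in U by lra.
    (* The combination of [k] times the differentiated identity and [- 2 m] times the identity
       itself cancels every term outside the factor [k k' - m^2]. *)
    transitivity (k x * 0 - 2 * m x * 0); [| ring].
    rewrite <- U at 1; rewrite <- Q; ring. }
  assert (Hm : m x = 0).
  { destruct (Rmult_integral _ _ Z) as [h | h]; auto; exfalso.
    assert (0 < s * s) by nra; assert (0 < 2 * (s * s) * L x) by nra; nra. }
  assert (HLk : L x * k x = 2 * s).
  { rewrite Hm in Q; apply Rmult_eq_reg_r with (k x); lra. }
  destruct (unit_speed_ab x) as [E1 E2]; repeat split; auto.
  - apply Rmult_eq_reg_r with s; lra.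
  - rewrite E2, Hm; ring.
Qed.

End UnitSpeed.

End Circle.

(** * Second order regularity and symmetry of the Hessian *)

Lemma smooth_C2 F DF HF : smooth F ->
  (forall i x, is_partial F i x (DF i x)) ->
  (forall i j x, is_partial (DF i) j x (HF i j x)) ->
  C1_with F DF /\ forall i, C1_with (DF i) (HF i).
Proof.
  intros HF0 H1 H2.
  assert (ext : forall G H : R3 -> R, (forall x, G x = H x) -> cont3 G -> cont3 H).
  { intros G H E HG x eps He; destruct (HG x eps He) as (d & Hd & h).
    exists d; split; auto; intros y Hy; rewrite <- !E; auto. }
  destruct (HF0 2%nat) as (_ & K).
  split; [| intros i]; split; auto; intros j.
  - destruct (K j) as (G & HG & (cG & _)); apply (ext G); auto.
    intros x; exact (is_partial_unique _ _ _ _ _ (HG x) (H1 j x)).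
  - destruct (K i) as (G & HG & (_ & KG)).
    destruct (KG j) as (G' & HG' & cG'); apply (ext G'); auto.
    assert (E : forall y, G y = DF i y) by
      (intros y; exact (is_partial_unique _ _ _ _ _ (HG y) (H1 i y))).
    intros x; apply (is_partial_unique (DF i) j x); auto.
    intros eps He; destruct (HG' x eps He) as (d & Hd); exists d.
    intros h h0 hd; rewrite <- !E; auto.
Qed.

Lemma hessian_sym F DF HF i j x : C1_with F DF -> (forall i, C1_with (DF i) (HF i)) ->
  HF i j x = HF j i x.
Proof.
  intros H1 H2.
  set (pt := fun u v => vadd x (vadd (vscal u (basis i)) (vscal v (basis j)))).
  assert (Pu : forall u v, curve_derive (fun z => pt z v) u (basis i)).
  { intros u v l; unfold pt; destruct i, j, l; cbn; auto_derive; auto; ring. }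
  assert (Pv : forall u v, curve_derive (fun z => pt u z) v (basis j)).
  { intros u v l; unfold pt; destruct i, j, l; cbn; auto_derive; auto; ring. }
  assert (Db : forall (A : idx -> R3 -> R) l y, dot (grad A y) (basis l) = A l y).
  { intros A l y; destruct l; unfold dot, grad; cbn; ring. }
  assert (Du : forall (G : R3 -> R) DG u v, C1_with G DG ->
     is_derive (fun z => G (pt z v)) u (DG i (pt u v))).
  { intros G DG u v HG; rewrite <- (Db DG i).
    exact (is_derive_comp_C1 G DG (fun z => pt z v) u _ HG (Pu u v)). }
  assert (Dv : forall (G : R3 -> R) DG u v, C1_with G DG ->
     is_derive (fun z => G (pt u z)) v (DG j (pt u v))).
  { intros G DG u v HG; rewrite <- (Db DG j).
    exact (is_derive_comp_C1 G DG (fun z => pt u z) v _ HG (Pv u v)). }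
  set (f := fun u v => F (pt u v)).
  assert (E1 : forall u v, Derive (fun t => f u t) v = DF j (pt u v))
    by (intros u v; apply is_derive_unique, (Dv F); auto).
  assert (E2 : forall u v, Derive (fun t => f t v) u = DF i (pt u v))
    by (intros u v; apply is_derive_unique, (Du F); auto).
  assert (E3 : forall u v, Derive (fun z => Derive (fun t => f z t) v) u = HF j i (pt u v)).
  { intros u v; rewrite (Derive_ext _ (fun z => DF j (pt z v))) by auto.
    apply is_derive_unique, (Du (DF j)); auto. }
  assert (E4 : forall u v, Derive (fun z => Derive (fun t => f t z) u) v = HF i j (pt u v)).
  { intros u v; rewrite (Derive_ext _ (fun z => DF i (pt u z))) by auto.
    apply is_derive_unique, (Dv (DF i)); auto. }
  assert (C2 : forall G, cont3 G -> continuity_2d_pt (fun u v => G (pt u v)) 0 0).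
  { intros G HG eps; destruct (HG (pt 0 0) eps (cond_pos eps)) as (d & Hd & H).
    (* A coordinate of the displacement is at most [2 d / 5], even when [i = j], so its norm is at
       most [4 d / 5]. *)
    assert (h : 0 < d / 5) by lra.
    exists (mkposreal _ h); cbn; intros u v hu hv; apply H.
    apply Rle_lt_trans with (2 * (2 * (d / 5))); [| lra].
    rewrite Rminus_0_r in hu, hv.
    apply Rabs_def2 in hu; apply Rabs_def2 in hv.
    apply vnorm_le_coord; intros l; unfold pt; apply Rabs_le.
    destruct i, j, l; cbn; lra. }
  assert (E0 : pt 0 0 = x) by (unfold pt; destruct i, j; vec_eq).
  assert (X : Derive (fun z => Derive (fun t => f z t) 0) 0
            = Derive (fun z => Derive (fun t => f t z) 0) 0).
  { apply Schwarz.
    - exists (mkposreal 1 Rlt_0_1); intros u v _ _; repeat split.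
      + eexists; apply (Du F); eauto.
      + eexists; apply (Dv F); eauto.
      + apply (ex_derive_ext (fun z => DF j (pt z v))); [intros; now rewrite E1 |].
        eexists; apply (Du (DF j)); auto.
      + apply (ex_derive_ext (fun z => DF i (pt u z))); [intros; now rewrite E2 |].
        eexists; apply (Dv (DF i)); auto.
    - intros eps; destruct (C2 (HF j i) (proj2 (H2 j) i) eps) as (d & Hd); exists d.
      intros u v hu hv; rewrite !E3; auto.
    - intros eps; destruct (C2 (HF i j) (proj2 (H2 i) j) eps) as (d & Hd); exists d.
      intros u v hu hv; rewrite !E4; auto. }
  rewrite E3, E4, E0 in X; auto.
Qed.

Lemma is_derive_sign_change (g : R -> R) x l : is_derive g x l -> 0 < l -> g x = 0 ->
  forall eta, 0 < eta -> exists h, 0 < h < eta /\ 0 < g (x + h) /\ g (x - h) < 0.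
Proof.
  intros Hg Hl H0 eta He; apply is_derive_Reals in Hg.
  destruct (Hg (l / 2)) as (d & Hd); [lra |].
  pose proof (cond_pos d).
  assert (Hm : 0 < Rmin d eta) by (apply Rmin_glb_lt; auto).
  pose proof (Rmin_l d eta); pose proof (Rmin_r d eta).
  set (h := Rmin d eta / 2) in *.
  assert (Hh : 0 < h) by (unfold h; lra).
  exists h; split; [unfold h in *; lra |].
  assert (B1 : Rabs h < d) by (rewrite Rabs_pos_eq; unfold h in *; lra).
  assert (B2 : Rabs (- h) < d) by (rewrite Rabs_Ropp; auto).
  pose proof (Hd h ltac:(lra) B1) as K1; pose proof (Hd (- h) ltac:(lra) B2) as K2.
  rewrite H0 in K1, K2; apply Rabs_def2 in K1; apply Rabs_def2 in K2.
  change (x + - h) with (x - h) in K2.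
  set (y1 := g (x + h)) in *; set (y2 := g (x - h)) in *.
  replace y1 with ((y1 - 0) / h * h) by (field; lra).
  replace y2 with ((y2 - 0) / - h * - h) by (field; lra).
  split; nra.
Qed.

(** * Chords of a convex body *)

Section Body.

Variables (F : R3 -> R) (DF : idx -> R3 -> R) (HF : idx -> idx -> R3 -> R).
Hypothesis F_cont : cont3 F.
Hypothesis F_C1 : C1_with F DF.
Hypothesis F_C2 : forall i, C1_with (DF i) (HF i).
Hypothesis F_reg : forall p, F p = 0 -> grad DF p <> vzero.
Hypothesis F_bounded : bounded_set (fun x => F x <= 0).
Hypothesis F_convex : convex_set (fun x => F x <= 0).

Let G := grad DF.

Lemma line_derive B V t : curve_derive (fun r => vadd B (vscal r V)) t V.
Proof.
  refine (curve_derive_eq _ _ _ _ (curve_derive_add _ _ _ _ _ (curve_derive_const B t)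
    (curve_derive_scal (fun r => r) (fun _ => V) t 1 vzero _ (curve_derive_const V t))) _).
  - apply (is_derive_id (K := R_AbsRing)).
  - vec_eq.
Qed.

Lemma F_line_derive B V t :
  is_derive (fun r => F (vadd B (vscal r V))) t (dot (G (vadd B (vscal t V))) V).
Proof. exact (is_derive_comp_C1 F DF _ t V F_C1 (line_derive B V t)). Qed.

(** Otherwise [F] would become positive just after [q] on the segment towards [x], against
    convexity. *)
Lemma support_plane q x : F q = 0 -> F x <= 0 -> dot (G q) (vsub x q) <= 0.
Proof.
  intros Hq Hx; apply Rnot_lt_le; intros N.
  pose proof (F_line_derive q (vsub x q) 0) as D.
  assert (E0 : vadd q (vscal 0 (vsub x q)) = q) by vec_eq.
  rewrite E0 in D.
  destruct (is_derive_sign_change _ _ _ D N) with (eta := 1) as (h & Hh & P & _); [| lra |].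
  - rewrite E0; auto.
  - rewrite Rplus_0_l in P.
    pose proof (F_convex q x h ltac:(lra) Hx ltac:(lra)) as C; cbv beta in C.
    replace (vadd (vscal (1 - h) q) (vscal h x)) with (vadd q (vscal h (vsub x q))) in C
      by vec_eq.
    lra.
Qed.

(** A point with [F x < 0] can be pushed a little along [G q] and stay in the body; the weak
    inequality at the pushed point leaves a positive gap at [x]. *)
Lemma support_plane_strict q x : F q = 0 -> F x < 0 -> dot (G q) (vsub x q) < 0.
Proof.
  intros Hq Hx.
  destruct (F_cont x (- F x) ltac:(lra)) as (d & Hd & Hc).
  pose proof (vnorm_gt0 _ (F_reg q Hq)) as Hn; fold (G q) in Hn.
  set (e := d / 2 / vnorm (G q)).
  assert (He : 0 < e) by (unfold e; repeat apply Rdiv_lt_0_compat; lra).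
  assert (Hy : F (vadd x (vscal e (G q))) < 0).
  { assert (Hy : vnorm (vsub (vadd x (vscal e (G q))) x) < d).
    { replace (vsub (vadd x (vscal e (G q))) x) with (vscal e (G q)) by vec_eq.
      rewrite vnorm_scal by lra; unfold e.
      replace (d / 2 / vnorm (G q) * vnorm (G q)) with (d / 2) by (field; lra); lra. }
    apply Hc in Hy; apply Rabs_def2 in Hy; lra. }
  pose proof (support_plane q _ Hq (Rlt_le _ _ Hy)) as K.
  replace (vsub (vadd x (vscal e (G q))) q) with (vadd (vsub x q) (vscal e (G q))) in K
    by vec_eq.
  rewrite dot_addr, dot_scalr, <- vnorm_sqr in K.
  pose proof (Rmult_lt_0_compat _ _ He (Rmult_lt_0_compat _ _ Hn Hn)); lra.
Qed.

(** One notion for the two uses: radial projection from an interior point, and chords leaving the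
    surface strictly inwards. *)
Definition ray (B V : R3) : Prop :=
  V <> vzero /\ (F B < 0 \/ (F B = 0 /\ dot (G B) V < 0)).

Lemma ray_enters B V eta : ray B V -> 0 < eta ->
  exists e, 0 < e < eta /\ F (vadd B (vscal e V)) < 0.
Proof.
  intros (_ & HB) He.
  assert (E0 : vadd B (vscal 0 V) = B) by vec_eq.
  destruct HB as [HB | [HB HV]].
  - pose proof (is_derive_continuous _ _ _ (F_line_derive B V 0)) as Hc.
    assert (h : 0 < - F B) by lra.
    destruct (continuous_close _ _ _ Hc h) as (d & Hd).
    pose proof (cond_pos d).
    assert (Hm : 0 < Rmin d eta) by (apply Rmin_glb_lt; auto).
    pose proof (Rmin_l d eta); pose proof (Rmin_r d eta).
    exists (Rmin d eta / 2); split; [lra |].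
    assert (K : Rabs (F (vadd B (vscal (Rmin d eta / 2) V)) - F (vadd B (vscal 0 V))) < - F B).
    { apply Hd; change (Rabs (Rmin d eta / 2 - 0) < d); rewrite Rminus_0_r, Rabs_pos_eq; lra. }
    rewrite E0 in K; apply Rabs_def2 in K; lra.
  - pose proof (is_derive_opp (V := R_NormedModule) _ _ _ (F_line_derive B V 0)) as D.
    rewrite E0 in D; change (opp ?z) with (- z) in D.
    destruct (is_derive_sign_change _ _ _ D ltac:(lra)) with (eta := eta)
      as (h & Hh & P & _); auto.
    + change (- F (vadd B (vscal 0 V)) = 0); rewrite E0; lra.
    + change (0 < - F (vadd B (vscal (0 + h) V))) in P.
      rewrite Rplus_0_l in P; exists h; split; auto; lra.
Qed.

Lemma exit_transversal B V t : ray B V -> 0 < t -> F (vadd B (vscal t V)) = 0 ->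
  0 < dot (G (vadd B (vscal t V))) V.
Proof.
  intros HR Ht H0; destruct (ray_enters B V t HR Ht) as (e & He & HF1).
  pose proof (support_plane_strict _ _ H0 HF1) as K.
  replace (vsub (vadd B (vscal e V)) (vadd B (vscal t V))) with (vscal (e - t) V) in K
    by vec_eq.
  rewrite dot_scalr in K; nra.
Qed.

Lemma exit_unique B V t t' : ray B V -> 0 < t -> 0 < t' ->
  F (vadd B (vscal t V)) = 0 -> F (vadd B (vscal t' V)) = 0 -> t = t'.
Proof.
  intros HR.
  assert (W : forall r r', 0 < r -> F (vadd B (vscal r V)) = 0 ->
     F (vadd B (vscal r' V)) = 0 -> ~ r < r').
  { intros r r' Hr H0 H0' N; pose proof (exit_transversal _ _ _ HR Hr H0) as K1.
    pose proof (support_plane _ _ H0 (Req_le _ _ H0')) as K2.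
    replace (vsub (vadd B (vscal r' V)) (vadd B (vscal r V))) with (vscal (r' - r) V) in K2
      by vec_eq.
    rewrite dot_scalr in K2; nra. }
  intros Ht Ht' H0 H0'; pose proof (W t t' Ht H0 H0'); pose proof (W t' t Ht' H0' H0); lra.
Qed.

Lemma F_line_continuity B V : continuity (fun r => F (vadd B (vscal r V))).
Proof.
  intros r; apply continuity_pt_filterlim; eapply is_derive_continuous, F_line_derive.
Qed.

Lemma exit_exists B V : ray B V -> exists t, 0 < t /\ F (vadd B (vscal t V)) = 0.
Proof.
  intros HR; pose proof (proj1 HR) as HV.
  destruct (ray_enters B V 1 HR Rlt_0_1) as (e & He & Fe).
  destruct F_bounded as (M & HM).
  pose proof (dot_self_gt0 V HV) as HVV.
  (* By Cauchy-Schwarz this [t] takes the ray out of the ball of radius [M]. The last [+ 1] puts [t]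
     beyond the entering time [e < 1]. *)
  set (t := (Rabs (dot B V) + Rabs M * vnorm V + 1) / dot V V + 1).
  assert (H1 : 0 < Rabs (dot B V) + Rabs M * vnorm V + 1).
  { pose proof (Rabs_pos (dot B V)).
    pose proof (Rmult_le_pos _ _ (Rabs_pos M) (vnorm_ge0 V)); lra. }
  assert (Ht : 1 < t) by (unfold t; pose proof (Rdiv_lt_0_compat _ _ H1 HVV); lra).
  assert (Ft : 0 < F (vadd B (vscal t V))).
  { apply Rnot_le_lt; intros N; apply HM in N.
    pose proof (cauchy_schwarz (vadd B (vscal t V)) V) as CS.
    rewrite dot_addl, dot_scall in CS.
    assert (E : t * dot V V = Rabs (dot B V) + Rabs M * vnorm V + 1 + dot V V)
      by (unfold t; field; lra).
    rewrite E in CS; pose proof (Rle_abs (- dot B V)) as A; rewrite Rabs_Ropp in A.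
    pose proof (Rle_abs (dot B V + (Rabs (dot B V) + Rabs M * vnorm V + 1 + dot V V))).
    pose proof (Rmult_le_compat_r _ _ _ (vnorm_ge0 V) N).
    pose proof (Rmult_le_compat_r _ _ _ (vnorm_ge0 V) (Rle_abs M)); lra. }
  destruct (IVT _ e t (F_line_continuity B V) ltac:(lra) Fe Ft) as (z & Hz & E).
  exists z; split; auto; lra.
Qed.

(** On a [ray] the chosen value is forced by [exit_exists] and [exit_unique]; elsewhere it is
    unspecified. *)
Definition exit_time (B V : R3) : R :=
  epsilon (inhabits 0) (fun t => 0 < t /\ F (vadd B (vscal t V)) = 0).

Definition exit_point (B V : R3) : R3 := vadd B (vscal (exit_time B V) V).

Lemma exit_spec B V : ray B V -> 0 < exit_time B V /\ F (exit_point B V) = 0.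
Proof. intros H; exact (epsilon_spec (inhabits 0) _ (exit_exists B V H)). Qed.

Lemma exit_time_eq B V t : ray B V -> 0 < t -> F (vadd B (vscal t V)) = 0 ->
  exit_time B V = t.
Proof.
  intros HR Ht H0; destruct (exit_spec B V HR) as (h1 & h2).
  apply (exit_unique B V); auto.
Qed.

Lemma locally_F_lt0 P t : curve_continuous P t -> F (P t) < 0 ->
  locally t (fun r => F (P r) < 0).
Proof.
  intros HP H0; pose proof (continuous_comp_curve F P t (F_cont _) HP) as Hc.
  assert (h : 0 < - F (P t)) by lra.
  generalize (continuous_close _ _ _ Hc h); apply filter_imp; intros r Hr; apply Rabs_def2 in Hr; lra.
Qed.

Lemma locally_F_gt0 P t : curve_continuous P t -> 0 < F (P t) ->
  locally t (fun r => 0 < F (P r)).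
Proof.
  intros HP H0; pose proof (continuous_comp_curve F P t (F_cont _) HP) as Hc.
  generalize (continuous_close _ _ _ Hc H0); apply filter_imp; intros r Hr; apply Rabs_def2 in Hr; lra.
Qed.

(** Transversality gives opposite signs of [F] at lengths [L - h] and [L + h]. The signs persist on
    nearby rays, so their unique exit lies between these lengths. *)
Lemma exit_time_continuous P V t u w : curve_derive P t u -> curve_derive V t w ->
  locally t (fun r => ray (P r) (V r)) ->
  continuous (fun r => exit_time (P r) (V r)) t.
Proof.
  intros HP HV HR; pose proof (locally_singleton _ _ HR) as R0.
  destruct (exit_spec _ _ R0) as (L0 & HL0); set (L := exit_time (P t) (V t)) in *.
  assert (Hc : forall c, curve_continuous (fun r => vadd (P r) (vscal c (V r))) t).
  { intros c; eapply curve_derive_continuous.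
    apply (curve_derive_add _ _ _ _ _ HP
      (curve_derive_scal (fun _ => c) V t 0 w (is_derive_Rconst c t) HV)). }
  apply filterlim_locally; intros eps.
  pose proof (exit_transversal _ _ _ R0 L0 HL0) as Tr.
  assert (Hm : 0 < Rmin eps L) by (apply Rmin_glb_lt; auto; apply cond_pos).
  pose proof (Rmin_l eps L); pose proof (Rmin_r eps L).
  destruct (is_derive_sign_change _ _ _ (F_line_derive (P t) (V t) L) Tr HL0 _ Hm)
    as (h & Hh & P1 & P2).
  generalize (filter_and _ _ HR (filter_and _ _
    (locally_F_lt0 _ t (Hc (L - h)) P2) (locally_F_gt0 _ t (Hc (L + h)) P1))).
  apply filter_imp; intros r (Rr & Q2 & Q1).
  destruct (IVT _ (L - h) (L + h) (F_line_continuity (P r) (V r)) ltac:(lra) Q2 Q1)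
    as (z & Hz & E).
  rewrite (exit_time_eq (P r) (V r) z); auto; [| lra].
  change (Rabs (z - L) < eps); apply Rabs_def1; lra.
Qed.

(** Implicit differentiation of [F (P + L V) = 0]: the slope of [F] turns it into an exact linear
    equation for the increment of [L], whose coefficient [den] is nonzero near [t] by
    transversality. *)
Lemma exit_time_derive P V t u w : curve_derive P t u -> curve_derive V t w ->
  locally t (fun r => ray (P r) (V r)) ->
  exists dL, is_derive (fun r => exit_time (P r) (V r)) t dL /\
    curve_derive (fun r => exit_point (P r) (V r)) t
      (vadd u (vadd (vscal dL (V t)) (vscal (exit_time (P t) (V t)) w))) /\
    dot (G (exit_point (P t) (V t)))
      (vadd u (vadd (vscal dL (V t)) (vscal (exit_time (P t) (V t)) w))) = 0.
Proof.
  intros HP HV HR; pose proof (locally_singleton _ _ HR) as R0.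
  destruct (exit_spec _ _ R0) as (L0 & HL0).
  pose proof (exit_transversal _ _ _ R0 L0 HL0) as Tr.
  pose proof (exit_time_continuous _ _ _ _ _ HP HV HR) as Lc.
  set (Lt := fun r => exit_time (P r) (V r)).
  change (continuous Lt t) in Lc.
  set (Q := fun r => exit_point (P r) (V r)).
  fold (exit_point (P t) (V t)) in Tr; fold (Q t) in HL0, Tr |- *; fold (Lt t) in L0 |- *.
  assert (Qc : curve_continuous Q t).
  { intros i; apply (continuous_ext (fun r => coord i (P r) + Lt r * coord i (V r))).
    - intros r; destruct i; reflexivity.
    - apply (continuous_plus (V := R_NormedModule) (fun r => coord i (P r))).
      + eapply is_derive_continuous, HP.
      + apply (continuous_mult (K := R_AbsRing) Lt (fun r => coord i (V r))); auto.
        eapply is_derive_continuous, HV. }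
  destruct (C1_slope F DF (Q t) F_C1) as (A & HA & HAx & HAc).
  assert (Ac : forall i, continuous (fun r => A i (Q r)) t)
    by (intros i; apply (continuous_comp_curve (A i)); auto).
  set (den := fun r => dot (grad A (Q r)) (V r)).
  assert (den0 : den t = dot (G (Q t)) (V t)).
  { unfold den, G; f_equal; unfold grad; rewrite !HAx; reflexivity. }
  assert (denc : continuous den t).
  { unfold den, dot.
    assert (K : forall i, continuous (fun r => A i (Q r) * coord i (V r)) t).
    { intros i; apply (continuous_mult (K := R_AbsRing) (fun r => A i (Q r)) (fun r => coord i (V r)));
        auto; eapply is_derive_continuous, HV. }
    apply (continuous_plus (V := R_NormedModule)); [apply (continuous_plus (V := R_NormedModule)) |].
    - exact (K I1).
    - exact (K I2).
    - exact (K I3). }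
  assert (den_pos : locally t (fun r => 0 < den r)).
  { assert (h : 0 < den t) by (rewrite den0; auto).
    generalize (continuous_close _ _ _ denc h); apply filter_imp; intros r Hr; apply Rabs_def2 in Hr; lra. }
  (* The end point with the length frozen at time [t], so that [Q r - Q t] is [(Lt r - Lt t) V r]
     plus the increment of [B]. *)
  set (B := fun r => vadd (P r) (vscal (Lt t) (V r))).
  assert (HB : curve_derive B t (vadd u (vscal (Lt t) w))).
  { refine (curve_derive_eq _ _ _ _ (curve_derive_add _ _ _ _ _ HP
      (curve_derive_scal (fun _ => Lt t) V t 0 w (is_derive_Rconst (Lt t) t) HV)) _); vec_eq. }
  assert (Hi : forall i, is_derive (fun r => - A i (Q r) / den r * (coord i (B r) - coord i (B t))) t
      (- DF i (Q t) / den t * coord i (vadd u (vscal (Lt t) w)))).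
  { intros i; rewrite <- HAx.
    apply (is_derive_continuous_mul (fun r => - A i (Q r) / den r) (fun r => coord i (B r))); auto.
    apply (continuous_mult (K := R_AbsRing) (fun r => - A i (Q r)) (fun r => / den r)).
    - apply (continuous_opp (V := R_NormedModule) (fun r => A i (Q r))); auto.
    - apply continuous_Rinv_comp; auto; rewrite den0; lra. }
  pose proof (is_derive_Rplus _ _ _ _ _ (is_derive_Rplus _ _ _ _ _ (Hi I1) (Hi I2)) (Hi I3)) as HS.
  pose proof (is_derive_Rplus _ _ _ _ _ (is_derive_Rconst (Lt t) t) HS) as HS'.
  set (dL := - dot (G (Q t)) (vadd u (vscal (Lt t) w)) / dot (G (Q t)) (V t)).
  assert (HL : is_derive Lt t dL).
  { refine (is_derive_ext_loc _ Lt t dL _ (is_derive_eq _ _ _ _ HS' _)).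
    - generalize (filter_and _ _ HR den_pos); apply filter_imp; intros r (Rr & dr).
      destruct (exit_spec _ _ Rr) as (_ & Fr); fold (Q r) in Fr.
      pose proof (HA (Q r)) as E; rewrite Fr, HL0 in E.
      assert (E' : (Lt r - Lt t) * den r + dot (grad A (Q r)) (vsub (B r) (B t)) = 0).
      { rewrite <- (Rminus_diag_eq 0 0 eq_refl), E at 1.
        unfold den, Q, exit_point, B; fold (Lt r) (Lt t); unfold dot; cbn; ring. }
      apply Rmult_eq_reg_r with (den r); [| lra].
      apply Rminus_diag_uniq; rewrite <- Ropp_0, <- E'.
      unfold dot, vsub; cbn [x1 x2 x3 grad coord]; field; lra.
    - unfold dL; rewrite <- den0; unfold dot; cbn; unfold G, grad; cbn; field.
      rewrite den0; lra. }
  assert (HQ : curve_derive Q t (vadd u (vadd (vscal dL (V t)) (vscal (Lt t) w)))).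
  { exact (curve_derive_add _ _ _ _ _ HP (curve_derive_scal Lt V t dL w HL HV)). }
  exists dL; split; [exact HL | split; [exact HQ |]].
  unfold dL; rewrite !dot_addr, !dot_scalr; field; lra.
Qed.


(** * The second fundamental form *)

Definition nrm (x : R3) : R3 := vscal (- / vnorm (G x)) (G x).
Definition hess (x u : R3) : R3 :=
  mkR3 (dot (grad (HF I1) x) u) (dot (grad (HF I2) x) u) (dot (grad (HF I3) x) u).
Definition sff (x u w : R3) : R := dot (hess x u) w / vnorm (G x).

Lemma G_norm_gt0 x : F x = 0 -> 0 < vnorm (G x).
Proof. intros H; apply vnorm_gt0, F_reg, H. Qed.

Lemma nrm_unit x : F x = 0 -> dot (nrm x) (nrm x) = 1.
Proof.
  intros H; pose proof (G_norm_gt0 x H); unfold nrm.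
  rewrite dot_scalr, dot_scall, <- vnorm_sqr; field; lra.
Qed.

Lemma dot_G x y : F x = 0 -> dot (G x) y = - vnorm (G x) * dot (nrm x) y.
Proof.
  intros H; pose proof (G_norm_gt0 x H); unfold nrm; rewrite dot_scall; field; lra.
Qed.

Lemma dot_nrm_of_G x y : F x = 0 -> dot (G x) y = 0 -> dot (nrm x) y = 0.
Proof. intros _ H; unfold nrm; rewrite dot_scall, H; ring. Qed.

Lemma sff_sym x u w : sff x u w = sff x w u.
Proof.
  unfold sff, hess, dot, grad; cbn.
  rewrite (hessian_sym F DF HF I2 I1), (hessian_sym F DF HF I3 I1),
    (hessian_sym F DF HF I3 I2) by auto; f_equal; ring.
Qed.

Lemma sff_addl x u v w : sff x (vadd u v) w = sff x u w + sff x v w.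
Proof. unfold sff, hess, Rdiv; vec_ring. Qed.

Lemma sff_scall x a u w : sff x (vscal a u) w = a * sff x u w.
Proof. unfold sff, hess, Rdiv; vec_ring. Qed.

Lemma sff_addr x u v w : sff x w (vadd u v) = sff x w u + sff x w v.
Proof. rewrite sff_sym, sff_addl, !(sff_sym x w); reflexivity. Qed.

Lemma sff_scalr x a u w : sff x w (vscal a u) = a * sff x w u.
Proof. rewrite sff_sym, sff_scall, (sff_sym x w); reflexivity. Qed.

Lemma curve_derive_grad P t u : curve_derive P t u ->
  curve_derive (fun r => G (P r)) t (hess (P t) u).
Proof.
  intros HP i; pose proof (is_derive_comp_C1 (DF i) (HF i) P t u (F_C2 i) HP) as H.
  destruct i; exact H.
Qed.

(** The Weingarten equation; the minus sign is the convention that [sff] is taken with respect to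
    the inner normal. *)
Lemma nrm_derive P t u : F (P t) = 0 -> curve_derive P t u ->
  exists dn, curve_derive (fun r => nrm (P r)) t dn /\
    dot dn (nrm (P t)) = 0 /\
    forall w, dot (nrm (P t)) w = 0 -> dot dn w = - sff (P t) u w.
Proof.
  intros H0 HP; pose proof (curve_derive_grad P t u HP) as HG.
  pose proof (G_norm_gt0 _ H0) as Hn.
  set (h := hess (P t) u) in *.
  assert (Hc : is_derive (fun r => - / vnorm (G (P r))) t
     (dot (G (P t)) h / (vnorm (G (P t)) * (vnorm (G (P t)) * vnorm (G (P t)))))).
  { pose proof (is_derive_dot _ _ _ _ _ HG HG) as D.
    set (q := fun r => dot (G (P r)) (G (P r))) in D.
    change (is_derive (fun r => - / sqrt (q r)) t
      (dot (G (P t)) h / (vnorm (G (P t)) * (vnorm (G (P t)) * vnorm (G (P t)))))).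
    assert (Hq : 0 < q t) by (unfold q; rewrite <- vnorm_sqr; nra).
    auto_derive.
    - repeat split; auto; [eexists; apply D | apply Rgt_not_eq, sqrt_lt_R0, Hq].
    - rewrite (is_derive_unique (fun y : R => q y) _ _ D).
      change (vnorm (G (P t))) with (sqrt (q t)); rewrite (dot_comm h).
      field; apply Rgt_not_eq, sqrt_lt_R0, Hq. }
  eexists; split; [exact (curve_derive_scal _ _ _ _ _ Hc HG) |].
  assert (Eg : dot (G (P t)) (G (P t)) = vnorm (G (P t)) * vnorm (G (P t)))
    by (now rewrite vnorm_sqr).
  split.
  - unfold nrm; rewrite dot_scalr, dot_addl, !dot_scall, Eg, (dot_comm h); field; lra.
  - intros w Hw; rewrite dot_addl, !dot_scall, (dot_G _ w H0), Hw.
    unfold sff; fold h; field; lra.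
Qed.

Definition tangent (p T : R3) : Prop := F p = 0 /\ orthonormal (nrm p) T.

Lemma tangent_decomp p T u : tangent p T -> dot (nrm p) u = 0 ->
  u = vadd (vscal (dot u T) T) (vscal (dot u (cross (nrm p) T)) (cross (nrm p) T)).
Proof.
  intros (H0 & Ho) Hu; destruct (orthonormal_cross _ _ Ho) as (c1 & c2 & c3).
  destruct Ho as (o1 & o2 & o3).
  apply (orthonormal_ext (nrm p) T); [repeat split; auto | | |];
    rewrite dot_addr, !dot_scalr.
  - rewrite Hu, o3, c1; ring.
  - rewrite o2, c2, (dot_comm T u); ring.
  - rewrite (dot_comm (cross (nrm p) T) T), c2, c3, (dot_comm (cross _ _) u); ring.
Qed.

Lemma sff_frame p T u w : tangent p T -> dot (nrm p) u = 0 -> dot (nrm p) w = 0 ->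
  let U := cross (nrm p) T in
  sff p u w = dot u T * dot w T * sff p T T
    + (dot u T * dot w U + dot u U * dot w T) * sff p T U
    + dot u U * dot w U * sff p U U.
Proof.
  intros Ht Hu Hw U.
  rewrite (tangent_decomp p T u Ht Hu) at 1; rewrite (tangent_decomp p T w Ht Hw) at 1.
  fold U; rewrite !sff_addl, !sff_scall, !sff_addr, !sff_scalr, (sff_sym p U T); ring.
Qed.

Lemma curve_tangent P t u : (forall r, F (P r) = 0) -> curve_derive P t u ->
  dot (nrm (P t)) u = 0.
Proof.
  intros H0 HP; apply dot_nrm_of_G; auto.
  pose proof (is_derive_comp_C1 F DF P t u F_C1 HP) as D.
  assert (Z : is_derive (fun r => F (P r)) t 0).
  { apply (is_derive_Rext (fun _ => 0)); [intros; now rewrite H0 | apply is_derive_Rconst]. }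
  exact (is_derive_inj _ _ _ _ D Z).
Qed.

Lemma ray_radial o V : F o < 0 -> V <> vzero -> ray o V.
Proof. intros H HV; split; auto. Qed.

Lemma radial_curve_derive o V t w : F o < 0 -> (forall r, V r <> vzero) ->
  curve_derive V t w -> exists dL, curve_derive (fun r => exit_point o (V r)) t
    (vadd (vscal dL (V t)) (vscal (exit_time o (V t)) w)).
Proof.
  intros Ho HV Hw.
  destruct (exit_time_derive (fun _ => o) V t vzero w (curve_derive_const o t) Hw)
    as (dL & _ & H & _).
  - apply filter_forall; intros r; apply ray_radial; auto.
  - exists dL; refine (curve_derive_eq _ _ _ _ H _); vec_eq.
Qed.

Lemma ray_of_dot p V : F p = 0 -> 0 < dot (nrm p) V -> ray p V.
Proof.
  intros H0 HV; split.
  - intros E; subst V; replace (dot (nrm p) vzero) with 0 in HV by vec_ring; lra.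
  - right; split; auto; rewrite dot_G by auto; pose proof (G_norm_gt0 p H0); nra.
Qed.

Lemma interior_exists p : F p = 0 -> exists o, F o < 0.
Proof.
  intros H0; assert (R0 : ray p (nrm p)) by (apply ray_of_dot; auto; rewrite nrm_unit; auto; lra).
  destruct (ray_enters _ _ 1 R0 Rlt_0_1) as (e & _ & He); eauto.
Qed.

(** The line [p + r T] projected radially from an interior point [o]. The velocity at 0 is [T] plus
    a multiple of [p - o]; it is tangent while [p - o] is transversal, so the multiple is 0. *)
Lemma surface_curve p T : F p = 0 -> dot (nrm p) T = 0 ->
  exists P, (forall r, F (P r) = 0) /\ P 0 = p /\ curve_derive P 0 T.
Proof.
  intros H0 HT; destruct (interior_exists p H0) as (o & Ho).
  pose proof (support_plane_strict p o H0 Ho) as Hs.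
  set (V := fun r => vadd (vsub p o) (vscal r T)).
  assert (GV : forall r, dot (G p) (V r) = - dot (G p) (vsub o p)).
  { intros r; unfold V; rewrite dot_addr, dot_scalr, (dot_G p T H0), HT; vec_ring. }
  assert (HV : forall r, V r <> vzero).
  { intros r E; pose proof (GV r) as K; rewrite E in K.
    replace (dot (G p) vzero) with 0 in K by vec_ring; lra. }
  destruct (radial_curve_derive o V 0 T Ho HV (line_derive (vsub p o) T 0)) as (dL & HD).
  assert (Vray : forall r, ray o (V r)) by (intros; apply ray_radial; auto).
  assert (E1 : exit_time o (V 0) = 1).
  { apply exit_time_eq; auto; [lra |].
    transitivity (F p); [f_equal; unfold V; vec_eq | auto]. }
  set (P := fun r => exit_point o (V r)) in *.
  assert (P0 : P 0 = p) by (unfold P, exit_point; rewrite E1; unfold V; vec_eq).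
  assert (PS : forall r, F (P r) = 0) by (intros r; exact (proj2 (exit_spec o (V r) (Vray r)))).
  exists P; split; [auto | split; [auto |]].
  refine (curve_derive_eq _ _ _ _ HD _); rewrite E1.
  pose proof (curve_tangent P 0 _ PS HD) as K; rewrite P0, E1 in K.
  rewrite dot_addr, !dot_scalr, HT in K.
  assert (Z : dot (nrm p) (V 0) <> 0).
  { intros Z; pose proof (GV 0) as K'; rewrite dot_G, Z in K' by auto; lra. }
  assert (dL = 0).
  { destruct (Rmult_integral dL (dot (nrm p) (V 0))); [lra | auto | contradiction]. }
  subst dL; vec_eq.
Qed.

(** The fixed vector [T] is projected to the tangent planes along [P] and normalised. The
    normalising factor is stationary at [t], so [W] has purely normal derivative there, as under
    parallel transport. *)
Lemma tangent_field P t u T : (forall r, F (P r) = 0) -> curve_derive P t u ->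
  tangent (P t) T ->
  exists W, W t = T /\ locally t (fun r => tangent (P r) (W r)) /\
    curve_derive W t (vscal (sff (P t) u T) (nrm (P t))).
Proof.
  intros HS HP (H0 & o1 & o2 & o3).
  destruct (nrm_derive P t u H0 HP) as (dn & Dn & n1 & n2).
  set (c := fun r => dot T (nrm (P r))).
  assert (c0 : c t = 0) by (unfold c; rewrite dot_comm; auto).
  assert (Dc : is_derive c t (- sff (P t) u T)).
  { refine (is_derive_eq _ _ _ _ (is_derive_dot _ _ _ _ _ (curve_derive_const T t) Dn) _).
    rewrite (dot_comm T dn), n2 by auto; vec_unfold; ring. }
  set (g := fun r => / sqrt (1 - c r * c r)).
  assert (g0 : g t = 1).
  { unfold g; rewrite c0; replace (1 - 0 * 0) with 1 by ring; rewrite sqrt_1; field. }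
  assert (Dg : is_derive g t 0).
  { unfold g; auto_derive.
    - rewrite c0; replace (1 + - (0 * 0)) with 1 by ring; rewrite sqrt_1.
      repeat split; try lra; eexists; apply Dc.
    - rewrite c0; replace (1 + - (0 * 0)) with 1 by ring; rewrite sqrt_1; field. }
  set (W := fun r => vscal (g r) (vadd T (vscal (- c r) (nrm (P r))))).
  exists W; split; [| split].
  - unfold W; rewrite g0, c0; vec_eq.
  - generalize (continuous_close c t 1 (is_derive_continuous _ _ _ Dc) Rlt_0_1).
    apply filter_imp; intros r Hr; rewrite c0, Rminus_0_r in Hr.
    apply Rabs_def2 in Hr.
    assert (Hp : 0 < 1 - c r * c r) by nra.
    pose proof (nrm_unit (P r) (HS r)) as Hn.
    repeat split; auto; unfold W.
    + rewrite !dot_scalr, !dot_scall, !dot_addr, !dot_addl, !dot_scalr, !dot_scall, Hn, o2.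
      rewrite (dot_comm (nrm (P r)) T); fold (c r).
      transitivity (g r * g r * (1 - c r * c r)); [ring |].
      unfold g; rewrite <- (sqrt_sqrt (1 - c r * c r)) at 3 by lra.
      field; apply Rgt_not_eq, sqrt_lt_R0, Hp.
    + rewrite !dot_scalr, !dot_addr, !dot_scalr, Hn, (dot_comm (nrm (P r)) T).
      fold (c r); ring.
  - assert (D1 : curve_derive (fun r => vadd T (vscal (- c r) (nrm (P r)))) t
        (vscal (sff (P t) u T) (nrm (P t)))).
    { refine (curve_derive_eq _ _ _ _ (curve_derive_add _ _ _ _ _ (curve_derive_const T t)
        (curve_derive_scal _ _ _ _ _ (is_derive_opp (V := R_NormedModule) _ _ _ Dc) Dn)) _).
      change (opp (c t)) with (- c t); change (opp (- sff (P t) u T)) with (- - sff (P t) u T).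
      rewrite c0; vec_eq. }
    refine (curve_derive_eq _ _ _ _ (curve_derive_scal _ _ _ _ _ Dg D1) _).
    rewrite g0; vec_eq.
Qed.

(** * Chords at the Gutkin angle *)

Variables (s C : R).
Hypothesis (s_gt0 : 0 < s) (C_gt0 : 0 < C) (sC1 : C * C + s * s = 1).
Hypothesis F_pos : forall p v, F p = 0 -> v <> vzero -> dot (G p) v = 0 -> 0 < sff p v v.
Hypothesis gutkin : forall p V, F p = 0 -> dot V V = 1 -> dot (nrm p) V = s ->
  dot (nrm (exit_point p V)) V = - s.

Definition chord_dir (p T : R3) : R3 := vadd (vscal C T) (vscal s (nrm p)).
Definition chord_len (p T : R3) : R := exit_time p (chord_dir p T).
Definition chord_end (p T : R3) : R3 := exit_point p (chord_dir p T).

(* With [v = chord_dir p T], [w = C n - s T] and [U = n x T], the normal at the far end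
   is [- s v + C (end_a w + end_b U)]. *)
Definition end_a (p T : R3) : R :=
  dot (nrm (chord_end p T)) (vsub (vscal C (nrm p)) (vscal s T)) / C.
Definition end_b (p T : R3) : R := dot (nrm (chord_end p T)) (cross (nrm p) T) / C.

Lemma sff_pos p v : F p = 0 -> v <> vzero -> dot (nrm p) v = 0 -> 0 < sff p v v.
Proof. intros H0 Hv Hd; apply F_pos; auto; rewrite dot_G, Hd by auto; ring. Qed.

Lemma tangent_neq0 p T : tangent p T -> T <> vzero.
Proof. intros (_ & _ & H & _) E; subst T; vec_unfold; lra. Qed.

Lemma tangent_cross p T : tangent p T -> tangent p (cross (nrm p) T).
Proof.
  intros (H0 & Ho); destruct (orthonormal_cross _ _ Ho) as (c1 & c2 & c3).
  split; auto; repeat split; auto; apply Ho.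
Qed.

Lemma gauss_pos p T : tangent p T ->
  0 < sff p T T * sff p (cross (nrm p) T) (cross (nrm p) T)
      - sff p T (cross (nrm p) T) * sff p T (cross (nrm p) T).
Proof.
  intros Ht; pose proof (tangent_cross p T Ht) as Hu.
  set (U := cross (nrm p) T) in *.
  assert (tu : dot T U = 0) by (unfold U; vec_ring).
  assert (k0 : 0 < sff p T T) by (apply sff_pos; [apply Ht | eapply tangent_neq0; eauto | apply Ht]).
  destruct Ht as (H0 & Ht); destruct Hu as (_ & Hu).
  (* Chosen orthogonal to [T] for the second fundamental form, so that [sff p v v] is [sff p T T]
     times the Gauss curvature. *)
  set (v := vadd (vscal (sff p T U) T) (vscal (- sff p T T) U)).
  assert (P : 0 < sff p v v).
  { apply sff_pos; auto.
    - intros E; assert (Z : dot v U = 0) by (rewrite E; vec_ring).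
      unfold v in Z; rewrite dot_addl, !dot_scall, tu, (proj1 (proj2 Hu)) in Z; lra.
    - unfold v; rewrite dot_addr, !dot_scalr, (proj2 (proj2 Hu)), (proj2 (proj2 Ht)); ring. }
  unfold v in P; rewrite !sff_addl, !sff_scall, !sff_addr, !sff_scalr, (sff_sym p U T) in P.
  apply Rmult_lt_reg_l with (sff p T T); auto; rewrite Rmult_0_r.
  eapply Rlt_le_trans; [exact P | right; ring].
Qed.

Section OneChord.

Variables (p T : R3).
Hypothesis Ht : tangent p T.

Let n := nrm p.
Let U := cross n T.
Let v := chord_dir p T.
Let L := chord_len p T.
Let q := chord_end p T.
Let nq := nrm q.
Let a := end_a p T.
Let b := end_b p T.

Lemma frame_dots : dot n n = 1 /\ dot T T = 1 /\ dot n T = 0 /\ dot n U = 0 /\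
  dot T U = 0 /\ dot U U = 1 /\ dot T n = 0 /\ dot U n = 0 /\ dot U T = 0.
Proof.
  destruct Ht as (_ & Ho); destruct (orthonormal_cross _ _ Ho) as (c1 & c2 & c3).
  destruct Ho as (o1 & o2 & o3).
  repeat split; auto; rewrite dot_comm; auto.
Qed.

Lemma chord_dir_unit : dot v v = 1.
Proof.
  destruct frame_dots as (h1 & h2 & h3 & _ & _ & _ & h4 & _).
  unfold v, chord_dir; fold n.
  rewrite !dot_addl, !dot_addr, !dot_scall, !dot_scalr, h1, h2, h3, h4; lra.
Qed.

Lemma chord_dir_nrm : dot n v = s.
Proof.
  destruct frame_dots as (h1 & h2 & h3 & _).
  unfold v, chord_dir; fold n; rewrite dot_addr, !dot_scalr, h1, h3; ring.
Qed.

Lemma chord_ray : ray p v.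
Proof. apply ray_of_dot; [apply Ht | fold n; rewrite chord_dir_nrm; auto]. Qed.

Lemma chord_len_gt0 : 0 < L.
Proof. exact (proj1 (exit_spec _ _ chord_ray)). Qed.

Lemma chord_end_surface : F q = 0.
Proof. exact (proj2 (exit_spec _ _ chord_ray)). Qed.

Lemma chord_end_dir : dot nq v = - s.
Proof. apply gutkin; [apply Ht | apply chord_dir_unit | apply chord_dir_nrm]. Qed.

Lemma chord_end_coords :
  dot nq T = - s * C * (1 + a) /\ dot nq n = C * C * a - s * s /\
  dot nq U = C * b /\ a * a + b * b = 1.
Proof.
  pose proof chord_end_dir as E.
  unfold v, chord_dir in E; fold n in E; rewrite dot_addr, !dot_scalr in E.
  assert (Ea : C * a = C * dot nq n - s * dot nq T).
  { unfold a, end_a; fold q nq n; rewrite dot_subr, !dot_scalr; field; lra. }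
  assert (Eb : dot nq U = C * b) by (unfold b, end_b; fold q nq n U; field; lra).
  assert (E1 : dot nq T = - s * C * (1 + a)).
  { transitivity ((C * C + s * s) * dot nq T); [rewrite sC1; ring |].
    replace (- s * C * (1 + a)) with (- s * C - s * (C * a)) by ring.
    rewrite Ea; replace (C * C * dot nq T) with (C * (C * dot nq T)) by ring; nra. }
  assert (E2 : dot nq n = C * C * a - s * s).
  { apply Rmult_eq_reg_l with s; [| lra].
    replace (s * dot nq n) with (- s - C * dot nq T) by lra; rewrite E1.
    transitivity (- s * (C * C + s * s) + s * (C * C) * (1 + a)); [rewrite sC1; ring | ring]. }
  repeat split; auto.
  pose proof (nrm_unit q chord_end_surface) as Hn; fold nq in Hn.
  rewrite (orthonormal_dot n T nq nq (proj2 Ht)) in Hn; fold U in Hn.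
  rewrite E1, E2, Eb in Hn.
  assert (Z : C * C * (a * a + b * b - 1) = 0).
  { assert (X : C * C = 1 - s * s) by lra.
    replace (C * C * (a * a + b * b - 1)) with (C * C * (a * a) + C * b * (C * b) - C * C) by ring.
    replace (- s * C * (1 + a) * (- s * C * (1 + a)))
      with (s * s * (C * C) * ((1 + a) * (1 + a))) in Hn by ring.
    rewrite X in *; lra. }
  destruct (Rmult_integral _ _ Z); nra.
Qed.

End OneChord.

(* Rotate the chord about its far end [q], within the cone of Gutkin directions at [q]:
   the angle at the moving end [p] stays constant, and differentiating this gives the
   relation.  Symmetry of the second fundamental form is what makes the curvatures at
   [p] in direction [T] appear. *)
Lemma chord_relation p T : tangent p T ->
  end_b p T * (chord_len p T * sff p T T - s)
  = - (s * sff p T (cross (nrm p) T) * chord_len p T * end_a p T).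
Proof.
  intros Ht.
  destruct (frame_dots p T Ht) as (h1 & h2 & h3 & h4 & h5 & h6 & h7 & h8 & h9).
  destruct (chord_end_coords p T Ht) as (E1 & E2 & E3 & E4).
  pose proof (chord_end_dir p T Ht) as Ev; pose proof (chord_dir_unit p T Ht) as Evv.
  pose proof (chord_dir_nrm p T Ht) as Env.
  pose proof (chord_end_surface p T Ht) as Hq; pose proof (chord_len_gt0 p T Ht) as HL.
  pose proof (nrm_unit _ Hq) as Hnq.
  set (n := nrm p) in *; set (U := cross n T) in *; set (v := chord_dir p T) in *.
  set (L := chord_len p T) in *; set (q := chord_end p T) in *; set (nq := nrm q) in *.
  set (a := end_a p T) in *; set (b := end_b p T) in *.
  (* The unit tangent at [q] for the reversed chord: [- v = C Tq + s nq]. *)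
  set (Tq := vscal (/ C) (vadd (vscal (-1) v) (vscal (- s) nq))).
  set (Uq := cross nq Tq).
  assert (Oq : orthonormal nq Tq).
  { assert (Evn : dot v nq = - s) by (rewrite dot_comm; auto).
    unfold Tq; repeat split; auto.
    - rewrite !dot_scall, !dot_scalr, !dot_addl, !dot_addr, !dot_scall, !dot_scalr.
      rewrite Evv, Hnq, Evn, Ev; transitivity ((1 - s * s) / (C * C)); [field; lra |].
      replace (1 - s * s) with (C * C) by lra; field; lra.
    - rewrite dot_scalr, dot_addr, !dot_scalr, Hnq, Ev; ring. }
  destruct (orthonormal_cross _ _ Oq) as (c1 & c2 & c3); fold Uq in c1, c2, c3.
  destruct Oq as (oq1 & oq2 & oq3).
  set (V := fun r => vadd (vscal (C * cos r) Tq) (vadd (vscal (C * sin r) Uq) (vscal s nq))).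
  assert (V0 : V 0 = vscal (-1) v).
  { unfold V; rewrite cos_0, sin_0; unfold Tq; clear - C_gt0; vec_eq; field; lra. }
  assert (DV : curve_derive V 0 (vscal C Uq)).
  { intros i; unfold V; destruct i; cbn; auto_derive; auto; rewrite cos_0, sin_0; ring. }
  assert (VV : forall r, dot (V r) (V r) = 1).
  { intros r; unfold V; rewrite (orthonormal_dot nq Tq) by (repeat split; auto).
    fold Uq; rewrite !dot_addl, !dot_scall, oq1, oq2, c3.
    rewrite (dot_comm Tq nq), oq3, (dot_comm Uq nq), c1, (dot_comm Uq Tq), c2.
    pose proof (sin2_cos2 r) as SC; unfold Rsqr in SC.
    transitivity (C * C * (sin r * sin r + cos r * cos r) + s * s); [ring |].
    rewrite SC; lra. }
  assert (NV : forall r, dot nq (V r) = s).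
  { intros r; unfold V; rewrite !dot_addr, !dot_scalr, oq1, oq3, c1; ring. }
  assert (RV : forall r, ray q (V r)).
  { intros r; apply ray_of_dot; auto; fold nq; rewrite NV; auto. }
  assert (Ep : vadd q (vscal L (vscal (-1) v)) = p).
  { unfold q, chord_end, exit_point, L, chord_len; fold v; vec_eq. }
  assert (EL : exit_time q (V 0) = L).
  { apply exit_time_eq; auto; rewrite V0, Ep; apply Ht. }
  destruct (exit_time_derive (fun _ => q) V 0 vzero _ (curve_derive_const q 0) DV)
    as (dL & _ & DP & _); [apply filter_forall; auto |].
  assert (Pp : exit_point q (V 0) = p) by (unfold exit_point; rewrite EL, V0, Ep; auto).
  set (P := fun r => exit_point q (V r)) in *; change (P 0 = p) in Pp.
  assert (PS : forall r, F (P r) = 0) by (intros r; exact (proj2 (exit_spec _ _ (RV r)))).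
  rewrite EL, V0 in DP.
  set (u := vadd vzero (vadd (vscal dL (vscal (-1) v)) (vscal L (vscal C Uq)))) in DP.
  destruct (nrm_derive P 0 u (PS 0) DP) as (dn & Dn & n1 & n2).
  pose proof (curve_tangent P 0 u PS DP) as Tu.
  rewrite Pp in n1, n2, Tu; fold n in n1, n2, Tu.
  pose proof (is_derive_dot _ _ _ _ _ Dn DV) as D1.
  assert (D0 : is_derive (fun r => dot (nrm (P r)) (V r)) 0 0).
  { apply (is_derive_Rext (fun _ => - s)); [| apply is_derive_Rconst].
    intros r; symmetry; apply gutkin; auto. }
  pose proof (is_derive_inj _ _ _ _ D0 D1) as Z; cbv beta in Z.
  rewrite V0, Pp in Z; fold n in Z.
  rewrite !dot_scalr in Z.
  assert (Edv : dot dn v = - C * sff p u T).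
  { unfold v, chord_dir; fold n; rewrite dot_addr, !dot_scalr, n1, n2 by auto; ring. }
  rewrite Edv in Z.
  assert (Su : sff p u T = dot u T * sff p T T + dot u U * sff p T U).
  { rewrite (sff_frame p T u T Ht) by auto; fold n U.
    rewrite h2, h5; ring. }
  assert (yU : dot Uq U = - a).
  { unfold Uq, Tq.
    transitivity (/ C * (- dot nq (cross v U))); [clear; vec_ring |].
    assert (X : cross v U = vsub (vscal C n) (vscal s T)).
    { assert (X : cross v U = vsub (vscal (C * dot T T + s * dot n T) n)
                                   (vscal (C * dot T n + s * dot n n) T)).
      { unfold v, chord_dir, U; fold n; clear; vec_eq. }
      rewrite X, h1, h2, h3, h7; f_equal; f_equal; ring. }
    rewrite X; unfold a, end_a; fold q nq n; field; lra. }
  assert (yN : dot n Uq = C * b).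
  { rewrite <- E3; unfold Uq, Tq.
    transitivity (/ C * (- dot nq (cross v n))); [clear; vec_ring |].
    assert (X : cross v n = vscal (- C) U).
    { unfold v, chord_dir, U; fold n; clear; vec_eq. }
    rewrite X, dot_scalr; field; lra. }
  assert (yv : dot Uq v = 0).
  { assert (X : v = vadd (vscal (- C) Tq) (vscal (- s) nq)).
    { unfold Tq; clear - C_gt0; vec_eq; field; lra. }
    rewrite X, dot_addr, !dot_scalr, (dot_comm Uq Tq), (dot_comm Uq nq), c1, c2; ring. }
  assert (yT : C * dot Uq T = - s * (C * b)).
  { rewrite <- yN; unfold v, chord_dir in yv; fold n in yv.
    rewrite dot_addr, !dot_scalr, (dot_comm Uq n) in yv; lra. }
  assert (vT : dot v T = C).
  { unfold v, chord_dir; fold n; rewrite dot_addl, !dot_scall, h2, h3; ring. }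
  assert (vU : dot v U = 0).
  { unfold v, chord_dir; fold n; rewrite dot_addl, !dot_scall, h4, h5; ring. }
  unfold u in Tu; rewrite !dot_addr, !dot_scalr, Env, yN in Tu.
  replace (dot n vzero) with 0 in Tu by (clear; vec_ring).
  (* Tangency of the velocity [u] of the moving end fixes the change of length. *)
  assert (EdL : s * dL = L * (C * (C * b))) by lra.
  assert (uT : s * dot u T = - (L * (C * b))).
  { unfold u; rewrite !dot_addl, !dot_scall, vT, yT.
    replace (dot vzero T) with 0 by (clear; vec_ring).
    transitivity (- (C * (s * dL)) - s * s * L * (C * b)); [ring |].
    rewrite EdL; transitivity (- (L * (C * b)) * (C * C + s * s)); [ring |].
    rewrite sC1; ring. }
  assert (uU : dot u U = - (L * C * a)).
  { unfold u; rewrite !dot_addl, !dot_scall, vU, yU.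
    replace (dot vzero U) with 0 by (clear; vec_ring); ring. }
  rewrite Su, yN, uU in Z.
  apply Rmult_eq_reg_l with (C * C); [| apply Rgt_not_eq; nra].
  assert (Z' : s * (C * (dot u T * sff p T T - L * C * a * sff p T U) + C * (C * b)) = 0)
    by (rewrite <- (Rmult_0_r s); f_equal; lra).
  replace (s * (C * (dot u T * sff p T T - L * C * a * sff p T U) + C * (C * b)))
    with (C * (s * dot u T) * sff p T T - s * (C * (L * C * a * sff p T U)) + s * (C * (C * b)))
    in Z' by ring.
  rewrite uT in Z'; lra.
Qed.

(** First variation of a chord transported along [P]; the last equation expresses that the far end
    moves tangentially. For [u = T] it reads [dL = C (mu - 1)] with
    [mu = a (L k - s) / s - L m b]. *)
Lemma chord_along P t u T W : (forall r, F (P r) = 0) -> curve_derive P t u ->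
  W t = T -> locally t (fun r => tangent (P r) (W r)) ->
  curve_derive W t (vscal (sff (P t) u T) (nrm (P t))) ->
  let p := P t in let n := nrm p in let U := cross n T in
  let nq := nrm (chord_end p T) in let L := chord_len p T in
  exists dL dv,
    is_derive (fun r => chord_len (P r) (W r)) t dL /\
    curve_derive (fun r => chord_dir (P r) (W r)) t dv /\
    curve_derive (fun r => chord_end (P r) (W r)) t
      (vadd u (vadd (vscal dL (chord_dir p T)) (vscal L dv))) /\
    dot n dv = C * sff p u T /\ dot T dv = - s * sff p u T /\ dot U dv = - s * sff p u U /\
    dot nq dv = C * (end_a p T * sff p u T - s * end_b p T * sff p u U) /\
    s * dL = dot nq u + L * dot nq dv.
Proof.
  intros PS HP HW HT DW p n U nq L.
  pose proof (locally_singleton _ _ HT) as Ht; cbv beta in Ht; rewrite HW in Ht; fold p in Ht.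
  destruct (nrm_derive P t u (PS t) HP) as (dn & Dn & n1 & n2); fold p in n1, n2; fold n in n1, n2.
  destruct (frame_dots p T Ht) as (h1 & h2 & h3 & h4 & h5 & h6 & h7 & h8 & h9).
  fold n in h1, h3, h4, h5, h6, h7, h8, h9; fold U in h4, h5, h6, h8, h9.
  destruct (chord_end_coords p T Ht) as (E1 & E2 & E3 & E4).
  fold nq n U in E1, E2, E3.
  assert (DD : curve_derive (fun r => chord_dir (P r) (W r)) t
     (vadd (vscal (C * sff p u T) n) (vscal s dn))).
  { refine (curve_derive_eq _ _ _ _ (curve_derive_add _ _ _ _ _
      (curve_derive_scal (fun _ => C) W t 0 _ (is_derive_Rconst C t) DW)
      (curve_derive_scal (fun _ => s) _ t 0 _ (is_derive_Rconst s t) Dn)) _).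
    fold p n; clear; vec_eq. }
  set (dv := vadd (vscal (C * sff p u T) n) (vscal s dn)) in *.
  assert (d1 : dot n dv = C * sff p u T).
  { unfold dv; rewrite dot_addr, !dot_scalr, h1, (dot_comm n dn), n1; ring. }
  assert (d2 : dot T dv = - s * sff p u T).
  { unfold dv; rewrite dot_addr, !dot_scalr, h7, (dot_comm T dn), n2 by auto; ring. }
  assert (d3 : dot U dv = - s * sff p u U).
  { unfold dv; rewrite dot_addr, !dot_scalr, h8, (dot_comm U dn), n2 by auto; ring. }
  assert (d4 : dot nq dv = C * (end_a p T * sff p u T - s * end_b p T * sff p u U)).
  { rewrite (orthonormal_dot n T nq dv (proj2 Ht)); fold U.
    rewrite E1, E2, E3, !(dot_comm dv), d1, d2, d3.
    transitivity (C * sff p u T * ((C * C + s * s) * end_a p T)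
                  - C * end_b p T * s * sff p u U); [ring | rewrite sC1; ring]. }
  destruct (exit_time_derive P (fun r => chord_dir (P r) (W r)) t u dv HP DD)
    as (dL & DL & DQ & Z).
  { revert HT; apply filter_imp; intros r Hr; apply chord_ray, Hr. }
  rewrite HW in DQ, Z; fold p in DQ, Z.
  exists dL, dv; repeat (split; [first [exact DL | exact DD | exact DQ | assumption] |]).
  pose proof (dot_nrm_of_G _ _ (chord_end_surface p T Ht) Z) as Z'; fold nq in Z'.
  rewrite !dot_addr, !dot_scalr in Z'.
  pose proof (chord_end_dir p T Ht) as Ev; fold nq in Ev; rewrite Ev in Z'.
  change (exit_time p (chord_dir p T)) with L in Z'; lra.
Qed.

(** When [p] moves along [T], these two conditions make the velocity of the far end a multiple of
    the chord direction, which is transversal there; so that velocity is 0, and the normal at the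
    far end is stationary too. Its constant product with the turning chord direction then gives
    [C k a = 0]. *)
Lemma chord_degenerate p T : tangent p T ->
  chord_len p T * sff p T T = s -> sff p T (cross (nrm p) T) = 0 -> end_a p T = 0.
Proof.
  intros Ht Hk Hm; pose proof Ht as (H0 & Ho).
  destruct (surface_curve p T H0 (proj2 (proj2 Ho))) as (P & PS & P0 & DP).
  rewrite <- P0 in Ht.
  destruct (tangent_field P 0 T T PS DP Ht) as (W & W0 & WT & DW).
  destruct (chord_along P 0 T T W PS DP W0 WT DW)
    as (dL & dv & DL & Dv & DQ & d1 & d2 & d3 & d4 & d5).
  rewrite P0 in *.
  destruct (frame_dots p T Ht) as (h1 & h2 & h3 & h4 & h5 & h6 & h7 & h8 & h9).
  pose proof (chord_len_gt0 p T Ht) as HL; pose proof (chord_end_dir p T Ht) as Ev.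
  pose proof (chord_end_surface p T Ht) as Hq.
  assert (Eq : vadd T (vadd (vscal dL (chord_dir p T)) (vscal (chord_len p T) dv))
             = vscal (C + dL) (chord_dir p T)).
  { apply (orthonormal_ext (nrm p) T); auto; unfold chord_dir;
      repeat rewrite ?dot_addr, ?dot_scalr.
    - rewrite d1, h1, h3.
      replace (chord_len p T * (C * sff p T T)) with (C * (chord_len p T * sff p T T)) by ring.
      rewrite Hk; ring.
    - rewrite d2, h2, h7.
      replace (chord_len p T * (- s * sff p T T)) with (- s * (chord_len p T * sff p T T)) by ring.
      rewrite Hk; transitivity (C * dL + (1 - s * s)); [ring |].
      replace (1 - s * s) with (C * C) by lra; ring.
    - rewrite d3, h8, h9, Hm; ring. }
  rewrite Eq in DQ.
  set (Q := fun r => chord_end (P r) (W r)) in *.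
  assert (Q0 : Q 0 = chord_end p T) by (unfold Q; rewrite P0, W0; auto).
  assert (QS : locally 0 (fun r => F (Q r) = 0)).
  { revert WT; apply filter_imp; intros r Hr; apply chord_end_surface, Hr. }
  assert (Zq : C + dL = 0).
  { pose proof (is_derive_comp_C1 F DF Q 0 _ F_C1 DQ) as D.
    assert (D0 : is_derive (fun r => F (Q r)) 0 0).
    { apply (is_derive_ext_loc (fun _ => 0)); [| apply is_derive_Rconst].
      revert QS; apply filter_imp; auto. }
    pose proof (is_derive_inj _ _ _ _ D D0) as Z; rewrite Q0 in Z.
    change (grad DF (chord_end p T)) with (G (chord_end p T)) in Z.
    rewrite dot_G, dot_scalr, Ev in Z by auto.
    pose proof (G_norm_gt0 _ Hq).
    assert (Z' : vnorm (G (chord_end p T)) * s * (C + dL) = 0) by lra.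
    destruct (Rmult_integral _ _ Z') as [z | z]; auto; nra. }
  rewrite Zq in DQ.
  rewrite <- Q0 in Hq; destruct (nrm_derive Q 0 _ Hq DQ) as (dn & Dn & n1 & n2).
  rewrite Q0 in *.
  assert (dn0 : dn = vzero).
  { destruct (exists_unit_orth (nrm (chord_end p T)) (nrm_unit _ Hq)) as (t & Ot).
    destruct (orthonormal_cross _ _ Ot) as (c1 & _ & _).
    assert (S0 : forall w, sff (chord_end p T) (vscal 0 (chord_dir p T)) w = 0)
      by (intros w; rewrite sff_scall; ring).
    apply (orthonormal_ext _ _ _ _ Ot); rewrite (dot_comm _ dn).
    - rewrite n1; vec_ring.
    - rewrite n2, S0 by apply Ot; vec_ring.
    - rewrite n2, S0 by auto; vec_ring. }
  pose proof (is_derive_dot _ _ _ _ _ Dn Dv) as D1; cbv beta in D1.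
  assert (D0 : is_derive (fun r => dot (nrm (Q r)) (chord_dir (P r) (W r))) 0 0).
  { apply (is_derive_ext_loc (fun _ => - s)); [| apply is_derive_Rconst].
    revert WT; apply filter_imp; intros r Hr; symmetry; apply chord_end_dir, Hr. }
  pose proof (is_derive_inj _ _ _ _ D0 D1) as Z; rewrite Q0, dn0, d4, Hm in Z.
  replace (dot vzero (chord_dir (P 0) (W 0))) with 0 in Z by vec_ring.
  assert (Z' : C * sff p T T * end_a p T = 0) by lra.
  assert (0 < sff p T T) by (apply sff_pos; auto; eapply tangent_neq0; eauto).
  destruct (Rmult_integral _ _ Z') as [z | z]; auto; nra.
Qed.

(** * Turning the direction at a fixed point *)

Definition rot (n e : R3) (x : R) : R3 := vadd (vscal (cos x) e) (vscal (sin x) (cross n e)).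

Lemma rot_derive n e x : curve_derive (rot n e) x
  (vadd (vscal (- sin x) e) (vscal (cos x) (cross n e))).
Proof. intros i; unfold rot; destruct i; cbn; auto_derive; auto; ring. Qed.

Lemma cross_rot n e x : orthonormal n e ->
  cross n (rot n e x) = vadd (vscal (- sin x) e) (vscal (cos x) (cross n e)).
Proof.
  intros (h1 & h2 & h3).
  transitivity (vadd (vscal (cos x) (cross n e))
    (vscal (sin x) (vsub (vscal (dot n e) n) (vscal (dot n n) e)))).
  - unfold rot; clear; vec_eq.
  - rewrite h1, h3; clear; vec_eq.
Qed.

Lemma rot_orthonormal n e x : orthonormal n e -> orthonormal n (rot n e x).
Proof.
  intros Ho; destruct (orthonormal_cross _ _ Ho) as (c1 & c2 & c3).
  destruct Ho as (h1 & h2 & h3); unfold rot; repeat split; auto.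
  - rewrite !dot_addl, !dot_addr, !dot_scall, !dot_scalr, h2, c2, c3, (dot_comm _ e), c2.
    pose proof (sin2_cos2 x) as SC; unfold Rsqr in SC; lra.
  - rewrite dot_addr, !dot_scalr, h3, c1; ring.
Qed.

Section TangentCircle.

Variables (p e : R3).
Hypothesis He : tangent p e.

Let n := nrm p.
Let T x := rot n e x.
Let U x := cross n (T x).

Lemma rot_tangent x : tangent p (T x).
Proof. split; [apply He | apply rot_orthonormal, He]. Qed.

Lemma cross_rot_at x : U x = vadd (vscal (- sin x) e) (vscal (cos x) (cross n e)).
Proof. apply cross_rot, He. Qed.

Lemma rot_sff x :
  sff p (T x) (T x) = cos x * cos x * sff p e e + 2 * (cos x * sin x) * sff p e (cross n e)
    + sin x * sin x * sff p (cross n e) (cross n e) /\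
  sff p (T x) (U x) = - (cos x * sin x) * sff p e e
    + (cos x * cos x - sin x * sin x) * sff p e (cross n e)
    + cos x * sin x * sff p (cross n e) (cross n e) /\
  sff p (U x) (U x) = sin x * sin x * sff p e e - 2 * (cos x * sin x) * sff p e (cross n e)
    + cos x * cos x * sff p (cross n e) (cross n e).
Proof.
  rewrite cross_rot_at; unfold T, rot.
  repeat rewrite ?sff_addl, ?sff_addr, ?sff_scall, ?sff_scalr.
  rewrite (sff_sym p (cross n e) e); repeat split; ring.
Qed.

(** The chord direction turns with velocity [C U]; that the far end moves in its tangent plane reads
    [s dL = C L (nq . U) = C^2 L b]. *)
Lemma chord_len_vertical x : is_derive (fun y => chord_len p (T y)) x
    (C * C / s * chord_len p (T x) * end_b p (T x)) /\
  ex_derive (fun y => end_a p (T y)) x /\ ex_derive (fun y => end_b p (T y)) x.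
Proof.
  pose proof (rot_tangent x) as Ht.
  assert (DT : curve_derive T x (U x)).
  { rewrite cross_rot_at; apply rot_derive. }
  assert (DU : curve_derive U x (vscal (-1) (T x))).
  { apply (curve_derive_ext_loc (fun y => vadd (vscal (- sin y) e) (vscal (cos y) (cross n e)))).
    - apply filter_forall; intros y; symmetry; apply cross_rot_at.
    - intros i; unfold T, rot; destruct i; cbn; auto_derive; auto; ring. }
  assert (DD : curve_derive (fun y => chord_dir p (T y)) x (vscal C (U x))).
  { refine (curve_derive_eq _ _ _ _ (curve_derive_add _ _ _ _ _
      (curve_derive_scal (fun _ => C) T x 0 _ (is_derive_Rconst C x) DT)
      (curve_derive_const (vscal s n) x)) _); clear; vec_eq. }
  destruct (exit_time_derive (fun _ => p) (fun y => chord_dir p (T y)) x vzero _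
     (curve_derive_const p x) DD) as (dL & DL & DQ & Z).
  { apply filter_forall; intros y; apply chord_ray, rot_tangent. }
  pose proof (chord_end_surface p _ Ht) as Hq.
  pose proof (dot_nrm_of_G _ _ Hq Z) as Z'.
  destruct (nrm_derive (fun y => chord_end p (T y)) x _ Hq DQ) as (dn & Dn & _).
  split; [| split].
  - refine (is_derive_eq _ _ _ _ DL _).
    rewrite !dot_addr, !dot_scalr in Z'.
    change (exit_point p (chord_dir p (T x))) with (chord_end p (T x)) in Z'.
    change (exit_time p (chord_dir p (T x))) with (chord_len p (T x)) in Z'.
    rewrite (chord_end_dir p _ Ht) in Z'.
    destruct (chord_end_coords p _ Ht) as (_ & _ & E3 & _).
    change (cross (nrm p) (T x)) with (U x) in E3; rewrite E3 in Z'.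
    replace (dot (nrm (chord_end p (T x))) vzero) with 0 in Z' by (clear; vec_ring).
    apply Rmult_eq_reg_l with s; [| lra].
    replace (s * (C * C / s * chord_len p (T x) * end_b p (T x)))
      with (C * C * chord_len p (T x) * end_b p (T x)) by (field; lra); lra.
  - pose proof (is_derive_dot _ _ _ _ _ Dn (curve_derive_add _ _ _ _ _
      (curve_derive_const (vscal C n) x)
      (curve_derive_scal (fun _ => - s) T x 0 _ (is_derive_Rconst (- s) x) DT))) as D.
    pose proof (is_derive_scal _ _ (/ C) _ D) as D'.
    eexists; refine (is_derive_Rext _ _ _ _ _ D'); intros y; cbv beta.
    unfold end_a, Rdiv; rewrite Rmult_comm; f_equal; f_equal; fold n; clear; vec_eq.
  - pose proof (is_derive_scal _ _ (/ C) _ (is_derive_dot _ _ _ _ _ Dn DU)) as D'.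
    eexists; refine (is_derive_Rext _ _ _ _ _ D'); intros y; cbv beta.
    unfold end_b, Rdiv; rewrite Rmult_comm; reflexivity.
Qed.

Lemma sff_vertical x :
  is_derive (fun y => sff p (T y) (T y)) x (2 * sff p (T x) (U x)) /\
  is_derive (fun y => sff p (T y) (U y)) x (sff p (U x) (U x) - sff p (T x) (T x)).
Proof.
  destruct (rot_sff x) as (E1 & E2 & E3); rewrite E1, E2, E3.
  split; (eapply is_derive_Rext; [intros y; symmetry; apply rot_sff |]).
  - auto_derive; auto; ring.
  - auto_derive; auto; ring.
Qed.

End TangentCircle.

(** * Evenness and unit speed for the chords of the surface *)

Lemma tangent_sff_gt0 p T : tangent p T -> 0 < sff p T T.
Proof. intros Ht; apply sff_pos; try apply Ht; eapply tangent_neq0; eauto. Qed.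

Lemma chord_even p T : tangent p T ->
  chord_len p (vscal (-1) T) = chord_len p T /\
  end_a p (vscal (-1) T) = end_a p T /\ end_b p (vscal (-1) T) = end_b p T.
Proof.
  intros Ht; set (R := rot (nrm p) T).
  assert (R0 : R 0 = T) by (unfold R, rot; rewrite cos_0, sin_0; vec_eq).
  assert (Rp : R (0 + PI) = vscal (-1) T)
    by (unfold R, rot; rewrite neg_cos, neg_sin, cos_0, sin_0; vec_eq).
  rewrite <- Rp, <- R0.
  assert (Rx : forall x, tangent p (R x)) by (intros x; apply rot_tangent; auto).
  apply (circle_even s C (fun x => chord_len p (R x)) (fun x => end_a p (R x))
    (fun x => end_b p (R x)) (fun x => sff p (R x) (R x))
    (fun x => sff p (R x) (cross (nrm p) (R x)))); auto; intros x.
  - apply chord_len_gt0, Rx.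
  - apply chord_end_coords, Rx.
  - apply chord_relation, Rx.
  - exact (proj1 (chord_len_vertical p T Ht x)).
  - exact (proj1 (sff_vertical p T Ht x)).
  - exact (proj1 (proj2 (chord_len_vertical p T Ht x))).
  - exact (proj2 (proj2 (chord_len_vertical p T Ht x))).
  - eexists; exact (proj2 (sff_vertical p T Ht x)).
  - apply chord_degenerate, Rx.
  - unfold R; rewrite (proj1 (rot_sff p T Ht (x + PI))), (proj1 (rot_sff p T Ht x)).
    rewrite neg_cos, neg_sin; ring.
  - unfold R; rewrite (proj1 (proj2 (rot_sff p T Ht (x + PI)))),
      (proj1 (proj2 (rot_sff p T Ht x))).
    rewrite neg_cos, neg_sin; ring.
  - f_equal; unfold R, rot; rewrite cos_plus, sin_plus, cos_2PI, sin_2PI.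
    f_equal; f_equal; ring.
Qed.

Lemma tangent_opp p T : tangent p T -> tangent p (vscal (-1) T).
Proof.
  intros (H0 & o1 & o2 & o3); repeat split; auto.
  - rewrite dot_scall, dot_scalr, o2; ring.
  - rewrite dot_scalr, o3; ring.
Qed.

(* [chord_len] is even in [T], so its derivative along the geodesic flow is odd in [T];
   by [chord_along] that derivative is [C (mu - 1)] with [mu] even, whence [mu = 1]. *)
Lemma chord_unit_speed p T : tangent p T ->
  end_a p T * (chord_len p T * sff p T T - s) / s
    - chord_len p T * sff p T (cross (nrm p) T) * end_b p T = 1.
Proof.
  intros Ht; pose proof Ht as (H0 & Ho).
  destruct (surface_curve p T H0 (proj2 (proj2 Ho))) as (P & PS & P0 & DP).
  rewrite <- P0 in Ht.
  destruct (tangent_field P 0 T T PS DP Ht) as (W & W0 & WT & DW).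
  destruct (chord_along P 0 T T W PS DP W0 WT DW)
    as (dL & dv & DL & _ & _ & _ & _ & _ & d4 & d5).
  (* The opposite field over the same curve, not the reversed curve: evenness makes both lengths
     agree along [P], whereas [chord_along] gives them opposite derivatives. *)
  set (W' := fun r => vscal (-1) (W r)).
  assert (WT' : locally 0 (fun r => tangent (P r) (W' r))).
  { revert WT; apply filter_imp; intros r; apply tangent_opp. }
  assert (DW' : curve_derive W' 0 (vscal (sff (P 0) T (vscal (-1) T)) (nrm (P 0)))).
  { refine (curve_derive_eq _ _ _ _
      (curve_derive_scal (fun _ => -1) W 0 0 _ (is_derive_Rconst (-1) 0) DW) _).
    rewrite sff_scalr; vec_eq. }
  assert (W0' : W' 0 = vscal (-1) T) by (unfold W'; rewrite W0; auto).
  destruct (chord_along P 0 T (vscal (-1) T) W' PS DP W0' WT' DW')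
    as (dL' & dv' & DL' & _ & _ & _ & _ & _ & d4' & d5').
  rewrite P0 in *.
  destruct (chord_even p T Ht) as (e1 & e2 & e3).
  destruct (chord_end_coords p T Ht) as (E1 & _ & _ & _).
  destruct (chord_end_coords p _ (tangent_opp p T Ht)) as (E1' & _ & _ & _).
  rewrite e1, e2, e3 in *.
  assert (Ed : dL = dL').
  { refine (is_derive_inj _ _ _ _ DL _).
    refine (is_derive_ext_loc _ _ _ _ _ DL').
    revert WT; apply filter_imp; intros r Hr; apply (chord_even (P r) (W r) Hr). }
  assert (EU : cross (nrm p) (vscal (-1) T) = vscal (-1) (cross (nrm p) T)) by vec_eq.
  rewrite EU, !sff_scalr in d4'.
  rewrite dot_scalr in E1'.
  rewrite E1, d4 in d5.
  replace (dot (nrm (chord_end p (vscal (-1) T))) T) with (s * C * (1 + end_a p T)) in d5' by lra.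
  rewrite d4' in d5'; subst dL'.
  set (k := sff p T T) in *; set (m := sff p T (cross (nrm p) T)) in *.
  set (L := chord_len p T) in *; set (a := end_a p T) in *; set (b := end_b p T) in *.
  assert (Z : C * (L * (a * k - s * b * m) - s * (1 + a)) = 0) by lra.
  destruct (Rmult_integral _ _ Z) as [z | z]; [lra |].
  apply Rmult_eq_reg_l with s; [| lra].
  transitivity (L * (a * k - s * b * m) - s * a); [field; lra | lra].
Qed.

(** * Umbilicity, constant chord length and constant centre *)

Lemma chord_umbilic p T : tangent p T ->
  sff p T (cross (nrm p) T) = 0 /\ chord_len p T * sff p T T = 2 * s /\
  end_a p T = 1 /\ end_b p T = 0.
Proof.
  intros Ht; set (X := rot (nrm p) T).
  assert (X0 : X 0 = T) by (unfold X, rot; rewrite cos_0, sin_0; vec_eq).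
  assert (Xx : forall x, tangent p (X x)) by (intros x; apply rot_tangent; auto).
  rewrite <- X0.
  apply (unit_speed_umbilic s C (fun x => chord_len p (X x)) (fun x => end_a p (X x))
    (fun x => end_b p (X x)) (fun x => sff p (X x) (X x))
    (fun x => sff p (X x) (cross (nrm p) (X x)))) with
    (k' := fun x => sff p (cross (nrm p) (X x)) (cross (nrm p) (X x))); auto; intros x.
  - apply chord_len_gt0, Xx.
  - apply tangent_sff_gt0, Xx.
  - apply chord_end_coords, Xx.
  - apply chord_relation, Xx.
  - exact (proj1 (chord_len_vertical p T Ht x)).
  - exact (proj1 (sff_vertical p T Ht x)).
  - exact (proj2 (sff_vertical p T Ht x)).
  - apply gauss_pos, Xx.
  - apply chord_unit_speed, Xx.
Qed.

Lemma sff_umbilic p T u w : tangent p T -> dot (nrm p) u = 0 -> dot (nrm p) w = 0 ->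
  sff p u w = sff p T T * dot u w.
Proof.
  intros Ht Hu Hw; rewrite (sff_frame p T u w Ht Hu Hw).
  destruct (chord_umbilic p T Ht) as (Hm & _); rewrite Hm.
  rewrite (orthonormal_dot (nrm p) T u w (proj2 Ht)), (dot_comm u (nrm p)), Hu.
  assert (Eq : sff p (cross (nrm p) T) (cross (nrm p) T) = sff p T T).
  (* The mixed term vanishes in every direction; at an angle where [cos] and [sin] are both nonzero
     this forces equal diagonal terms. *)
  { pose proof (rot_sff p T Ht (PI / 4)) as (_ & E & _).
    rewrite (proj1 (chord_umbilic p _ (rot_tangent p T Ht (PI / 4)))), Hm in E.
    assert (0 < cos (PI / 4) * sin (PI / 4)).
    { rewrite cos_PI4, sin_PI4; pose proof (sqrt_lt_R0 2 ltac:(lra)).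
      assert (0 < 1 / sqrt 2) by (apply Rdiv_lt_0_compat; lra); nra. }
    apply Rmult_eq_reg_l with (cos (PI / 4) * sin (PI / 4)); lra. }
  rewrite Eq; ring.
Qed.

Lemma chord_len_indep p T T' : tangent p T -> tangent p T' -> chord_len p T = chord_len p T'.
Proof.
  intros Ht Ht'.
  destruct (chord_umbilic p T Ht) as (_ & E & _).
  destruct (chord_umbilic p T' Ht') as (_ & E' & _).
  pose proof (tangent_sff_gt0 p T Ht).
  rewrite (sff_umbilic p T T' T' Ht), (proj1 (proj2 (proj2 Ht'))) in E' by apply Ht'.
  apply Rmult_eq_reg_r with (sff p T T); lra.
Qed.

Lemma tangent_exists p : F p = 0 -> exists T, tangent p T.
Proof.
  intros H0; destruct (exists_unit_orth _ (nrm_unit p H0)) as (T & HT).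
  exists T; split; auto.
Qed.

Definition some_tangent (p : R3) : R3 := epsilon (inhabits vzero) (tangent p).
Definition point_len (p : R3) : R := chord_len p (some_tangent p).

Lemma point_len_eq p T : tangent p T -> chord_len p T = point_len p.
Proof.
  intros Ht; apply chord_len_indep; auto.
  exact (epsilon_spec (inhabits vzero) (tangent p) (ex_intro _ T Ht)).
Qed.

(** With [a = 1] and [b = 0], [chord_along] gives [s dL = C (u . T) (L k - 2 s)] for every tangent
    [u], and the last factor is 0. *)
Lemma point_len_derive P t u : (forall r, F (P r) = 0) -> curve_derive P t u ->
  is_derive (fun r => point_len (P r)) t 0.
Proof.
  intros PS DP; destruct (tangent_exists (P t) (PS t)) as (T & Ht).
  destruct (tangent_field P t u T PS DP Ht) as (W & W0 & WT & DW).
  destruct (chord_along P t u T W PS DP W0 WT DW)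
    as (dL & dv & DL & _ & _ & _ & _ & _ & d4 & d5).
  pose proof (curve_tangent P t u PS DP) as Hu.
  destruct (chord_umbilic _ _ Ht) as (_ & Ek & Ea & Eb).
  destruct (chord_end_coords _ T Ht) as (E1 & _ & E3 & _).
  rewrite d4, Ea, Eb, (sff_umbilic _ T u T Ht Hu) in d5 by apply Ht.
  rewrite (orthonormal_dot (nrm (P t)) T _ u (proj2 Ht)), E1, E3, Ea, Eb,
    (dot_comm u (nrm (P t))), Hu in d5.
  assert (Z : s * dL = 0).
  { rewrite d5; transitivity (C * dot u T * (chord_len (P t) T * sff (P t) T T - 2 * s));
      [ring | rewrite Ek; ring]. }
  assert (dL = 0) by (destruct (Rmult_integral _ _ Z); lra); subst dL.
  refine (is_derive_ext_loc _ _ _ _ _ DL).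
  revert WT; apply filter_imp; intros r Hr; apply point_len_eq, Hr.
Qed.

(** Since [L k = 2 s], [l / (2 s)] is the radius of curvature [1 / k]. The length is a separate
    argument so that it stays frozen under differentiation along a curve. *)
Definition center (l : R) (p : R3) : R3 := vadd p (vscal (l / (2 * s)) (nrm p)).

Lemma center_derive P t u : (forall r, F (P r) = 0) -> curve_derive P t u ->
  curve_derive (fun r => center (point_len (P t)) (P r)) t vzero.
Proof.
  intros PS DP; destruct (tangent_exists (P t) (PS t)) as (T & Ht).
  destruct (nrm_derive P t u (PS t) DP) as (dn & Dn & n1 & n2).
  pose proof (curve_tangent P t u PS DP) as Hu.
  destruct (frame_dots (P t) T Ht) as (h1 & h2 & h3 & h4 & h5 & h6 & h7 & h8 & h9).
  destruct (chord_umbilic _ _ Ht) as (_ & Ek & _).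
  rewrite (point_len_eq _ _ Ht) in Ek.
  set (l := point_len (P t)) in *.
  refine (curve_derive_eq _ _ _ _ (curve_derive_add _ _ _ _ _ DP
    (curve_derive_scal (fun _ => l / (2 * s)) _ t 0 _ (is_derive_Rconst _ t) Dn)) _).
  assert (K : forall w, dot (nrm (P t)) w = 0 ->
     dot w u + l / (2 * s) * dot w dn = 0).
  { intros w Hw; rewrite (dot_comm w dn), n2, (sff_umbilic _ T u w Ht Hu Hw), (dot_comm u w) by auto.
    transitivity (dot w u * (1 - l * sff (P t) T T / (2 * s))); [field; lra |].
    rewrite Ek; field; lra. }
  assert (Zr : forall w, dot w vzero = 0) by (intros w; vec_ring).
  apply (orthonormal_ext _ _ _ _ (proj2 Ht)); rewrite Zr; repeat rewrite ?dot_addr, ?dot_scalr.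
  - rewrite Hu, (dot_comm _ dn), n1; ring.
  - rewrite Rmult_0_l, Rplus_0_l; apply K; auto.
  - rewrite Rmult_0_l, Rplus_0_l; apply K; auto.
Qed.

Lemma surface_path p p' : F p = 0 -> F p' = 0 ->
  exists P, (forall r, F (P r) = 0) /\ P 0 = p /\ P 1 = p' /\
    forall r, exists u, curve_derive P r u.
Proof.
  intros H0 H0'; destruct (interior_exists p H0) as (o & Ho).
  set (d := vsub p o); set (d' := vsub p' o).
  destruct (exists_orth2 d d') as (e & He & ed & ed').
  assert (nz : forall x, F x = 0 -> vsub x o <> vzero).
  { intros x Hx E; pose proof (support_plane_strict x o Hx Ho) as K.
    replace (vsub o x) with (vscal (-1) (vsub x o)) in K by vec_eq.
    rewrite E in K; replace (dot (G x) (vscal (-1) vzero)) with 0 in K by vec_ring; lra. }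
  (* The term in [e], zero at both ends and orthogonal to [d] and [d'], keeps [V] away from 0 even
     when [d] and [d'] point in opposite directions. *)
  set (V := fun r => vadd (vscal (1 - r) d) (vadd (vscal r d') (vscal (r * (1 - r)) e))).
  assert (V0 : V 0 = d) by (unfold V; vec_eq).
  assert (V1 : V 1 = d') by (unfold V; vec_eq).
  assert (HV : forall r, V r <> vzero).
  { intros r E; assert (Z : dot e (V r) = 0) by (rewrite E; vec_ring).
    unfold V in Z; rewrite !dot_addr, !dot_scalr, ed, ed' in Z.
    pose proof (dot_self_gt0 e He).
    assert (Z' : dot e e * (r * (1 - r)) = 0) by lra.
    destruct (Rmult_integral _ _ Z') as [z | z]; [lra |].
    destruct (Rmult_integral _ _ z) as [z1 | z1].
    - subst r; rewrite V0 in E; exact (nz p H0 E).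
    - replace r with 1 in E by lra; rewrite V1 in E; exact (nz p' H0' E). }
  assert (Ex : forall x, F x = 0 -> exit_point o (vsub x o) = x).
  { intros x Hx; unfold exit_point.
    assert (E : vadd o (vscal 1 (vsub x o)) = x) by vec_eq.
    rewrite (exit_time_eq o (vsub x o) 1); auto; [apply ray_radial; auto | lra | now rewrite E]. }
  exists (fun r => exit_point o (V r)); split; [| split; [| split]].
  - intros r; exact (proj2 (exit_spec _ _ (ray_radial o (V r) Ho (HV r)))).
  - rewrite V0; apply Ex; auto.
  - rewrite V1; apply Ex; auto.
  - intros r.
    assert (DV : curve_derive V r (vadd (vsub d' d) (vscal (1 - 2 * r) e))).
    { intros i; unfold V; destruct i; cbn; auto_derive; auto; ring. }
    destruct (radial_curve_derive o V r _ Ho HV DV) as (dL & HD); eauto.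
Qed.

Lemma center_const p p' : F p = 0 -> F p' = 0 ->
  point_len p = point_len p' /\ center (point_len p) p = center (point_len p) p'.
Proof.
  intros H0 H0'; destruct (surface_path p p' H0 H0') as (P & PS & P0 & P1 & DP).
  assert (El : forall r, point_len (P r) = point_len p).
  { intros r; rewrite <- P0; apply (is_derive_zero_const (fun y => point_len (P y))).
    intros y; destruct (DP y) as (u & Hu); apply (point_len_derive P y u); auto. }
  split; [rewrite <- P1; auto |].
  apply R3_ext; intros i; rewrite <- P0 at 2; rewrite <- P1.
  apply (is_derive_zero_const (fun y => coord i (center (point_len p) (P y)))).
  intros y; destruct (DP y) as (u & Hu).
  pose proof (center_derive P y u PS Hu i) as D; rewrite El in D.
  replace (coord i vzero) with 0 in D by (destruct i; reflexivity); exact D.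
Qed.

(** The constant centre only puts the surface inside a sphere. Conversely, the centre is interior,
    so the ray from it through any point of the sphere meets the surface, at distance [r] and hence
    at that point. *)
Lemma table_round : (exists p, F p = 0) -> round_sphere (fun x => F x = 0).
Proof.
  intros (p & H0); set (l := point_len p); set (c := center l p); set (r := l / (2 * s)).
  assert (Hr : 0 < r).
  { destruct (tangent_exists p H0) as (T & Ht); unfold r, l; rewrite <- (point_len_eq p T Ht).
    apply Rdiv_lt_0_compat; [apply chord_len_gt0, Ht | lra]. }
  assert (HS : forall x, F x = 0 -> vsub x c = vscal (- r) (nrm x)).
  { intros x Hx; assert (Ec : c = center l x) by exact (proj2 (center_const p x H0 Hx)).
    rewrite Ec; unfold center; fold r; vec_eq. }
  assert (Hd : forall x, F x = 0 -> dot (vsub x c) (vsub x c) = r * r).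
  { intros x Hx; rewrite (HS x Hx), dot_scall, dot_scalr, (nrm_unit x Hx); ring. }
  assert (Hn : forall x, dot (vsub x c) (vsub x c) = r * r <-> vnorm (vsub x c) = r).
  { intros x; split; intros E.
    - unfold vnorm; rewrite E; apply sqrt_square; lra.
    - rewrite <- vnorm_sqr, E; ring. }
  assert (Fc : F c < 0).
  { assert (Rp : ray p (nrm p)) by (apply ray_of_dot; auto; rewrite nrm_unit; auto; lra).
    destruct (exit_exists _ _ Rp) as (t & Ht & Hq).
    pose proof (Hd _ Hq) as E.
    replace (vsub (vadd p (vscal t (nrm p))) c) with (vscal (t - r) (nrm p)) in E.
    2: { transitivity (vadd (vsub p c) (vscal t (nrm p))); [rewrite HS by auto |]; vec_eq. }
    rewrite dot_scall, dot_scalr, nrm_unit in E by auto.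
    (* The normal chord at [p] is a diameter, so [c] is its midpoint and lies in the body; [F c = 0]
       would put [c] at distance [r > 0] from itself. *)
    assert (Et : t = 2 * r) by nra.
    pose proof (F_convex p _ (/ 2) (Req_le _ _ H0) (Req_le _ _ Hq) ltac:(lra)) as Hc.
    cbv beta in Hc.
    replace (vadd (vscal (1 - / 2) p) (vscal (/ 2) (vadd p (vscal t (nrm p))))) with c in Hc.
    2: { unfold c, center; fold r; rewrite Et; vec_eq; field. }
    destruct Hc as [Hc | Hc]; auto.
    exfalso; pose proof (Hd c Hc) as Z.
    replace (dot (vsub c c) (vsub c c)) with 0 in Z by vec_ring; nra. }
  exists c, r; split; auto; intros x; rewrite <- Hn; split; [apply Hd |].
  intros Hx.
  assert (Vx : vsub x c <> vzero).
  { intros E; rewrite E in Hx; replace (dot vzero vzero) with 0 in Hx by vec_ring; nra. }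
  destruct (exit_exists _ _ (ray_radial c _ Fc Vx)) as (t & Ht & Hq).
  pose proof (Hd _ Hq) as E.
  replace (vsub (vadd c (vscal t (vsub x c))) c) with (vscal t (vsub x c)) in E by vec_eq.
  rewrite dot_scall, dot_scalr, Hx in E.
  assert (Et : t = 1).
  { assert (Z : (t - 1) * ((t + 1) * (r * r)) = 0) by lra.
    destruct (Rmult_integral _ _ Z) as [z | z]; [lra |].
    assert (0 < (t + 1) * (r * r)) by (apply Rmult_lt_0_compat; nra); lra. }
  rewrite <- Hq, Et; f_equal; vec_eq.
Qed.

End Body.

(** * The Gutkin condition as a signed identity *)

Theorem theorem1p1 (S : R3 -> Prop) (delta : R) :
  gutkin_table S delta -> round_sphere S.
Proof.
  intros ((d0 & d1) & F & DF & HF & Fs & FD & FH & FS & (p & Hp) & Freg & Fb & Fc & Fpos & Fg).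
  destruct (smooth_C2 F DF HF Fs FD FH) as (C1 & C2).
  assert (s0 : 0 < sin delta) by (apply sin_gt_0; lra).
  assert (c0 : 0 < cos delta) by (apply cos_gt_0; lra).
  assert (sc : cos delta * cos delta + sin delta * sin delta = 1).
  { pose proof (sin2_cos2 delta) as E; unfold Rsqr in E; lra. }
  assert (Freg' : forall x, F x = 0 -> grad DF x <> vzero) by (intros x Hx; apply Freg, FS, Hx).
  assert (Fpos' : forall x v, F x = 0 -> v <> vzero -> dot (grad DF x) v = 0 ->
     0 < sff DF HF x v v).
  { intros x v Hx Hv Hd; unfold sff; apply Rdiv_lt_0_compat.
    - replace (dot (hess HF x v) v) with (hess_form HF x v).
      + apply Fpos; auto; apply FS, Hx.
      + unfold hess_form, hess, dot, grad; cbn; ring.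
    - apply vnorm_gt0, Freg', Hx. }
  (* The angle fixes only the absolute value of the product with the normal at the far end; the sign
     comes from the transversal exit of the chord. *)
  assert (Gk : forall x V, F x = 0 -> dot V V = 1 -> dot (nrm DF x) V = sin delta ->
     dot (nrm DF (exit_point F x V)) V = - sin delta).
  { intros x V Hx HV Hd.
    pose proof (ray_of_dot F DF Freg' x V Hx ltac:(lra)) as Hr.
    destruct (exit_spec F DF C1 Fb x V Hr) as (L0 & Hq).
    pose proof (exit_transversal F DF (Fs 0%nat) C1 Freg' Fc x V _ Hr L0 Hq) as Tr.
    fold (exit_point F x V) in Tr.
    set (L := exit_time F x V) in *; set (q := exit_point F x V) in *.
    assert (Eq : vsub q x = vscal L V) by (unfold q, exit_point; fold L; vec_eq).
    assert (nV : vnorm (vscal L V) = L) by (rewrite vnorm_scal, vnorm_unit; auto; lra).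
    assert (ang : forall y, F y = 0 -> angle_vec_plane (vscal L V) (grad DF y)
        = asin (Rabs (dot (nrm DF y) V))).
    { intros y Hy; pose proof (vnorm_gt0 _ (Freg' y Hy)).
      unfold angle_vec_plane, nrm; f_equal; rewrite nV, !dot_scall, (dot_comm V).
      rewrite !Rabs_mult, Rabs_Ropp, Rabs_inv, !(Rabs_pos_eq L), (Rabs_pos_eq (vnorm _)) by lra.
      field; lra. }
    assert (ne : x <> q).
    { intros E; rewrite <- E in Eq; replace (vsub x x) with vzero in Eq by vec_eq.
      rewrite <- Eq in nV; unfold vnorm in nV.
      replace (dot vzero vzero) with 0 in nV by vec_ring; rewrite sqrt_0 in nV; lra. }
    assert (A1 : angle_vec_plane (vsub q x) (grad DF x) = delta).
    { rewrite Eq, ang, Hd, Rabs_pos_eq by (auto; lra); apply asin_sin; lra. }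
    pose proof (Fg x q (proj2 (FS x) Hx) (proj2 (FS q) Hq) ne A1) as A2.
    rewrite Eq, ang in A2 by auto.
    assert (Bd : Rabs (dot (nrm DF q) V) <= 1).
    { eapply Rle_trans; [apply cauchy_schwarz |].
      rewrite (vnorm_unit V HV), vnorm_unit; [lra | apply (nrm_unit F DF); auto]. }
    assert (E : Rabs (dot (nrm DF q) V) = sin delta).
    { rewrite <- A2, sin_asin; auto; split; auto.
      pose proof (Rabs_pos (dot (nrm DF q) V)); lra. }
    rewrite (dot_G F DF) in Tr by auto; pose proof (vnorm_gt0 _ (Freg' q Hq)).
    assert (dot (nrm DF q) V < 0) by nra.
    rewrite Rabs_left in E by auto; lra. }
  destruct (table_round F DF HF (Fs 0%nat) C1 C2 Freg' Fb Fc (sin delta) (cos delta)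
     s0 c0 sc Fpos' Gk) as (c & r & Hr & H).
  - exists p; apply FS, Hp.
  - exists c, r; split; auto; intros x; rewrite FS; apply H.
Qed.
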